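(* Let $\alpha>0$. The spectrum of the generalized Alexander operator $C_{g_0}:\mathcal{B}_\alpha^0\to\mathcal{B}_\alpha^0$ is $\sigma(C_{g_0})=\{g_0(0)/n: n\in\mathbb{N}\}\cup\{0\}$, where $0$ is an approximate eigenvalue.
   Context: $\mathbb{D}=\{z\in\mathbb{C}:|z|<1\}$. For $\alpha>0$, the $\alpha$-Bloch space $\mathcal{B}_\alpha$ is the space of analytic functions $f$ on $\mathbb{D}$ with $\|f\|_{\mathcal{B}_\alpha}:=\sup_{z\in\mathbb{D}}(1-|z|^2)^\alpha|f'(z)|<\infty$. $\mathcal{B}_\alpha^0=\{f\in\mathcal{B}_\alpha: f(0)=0\}$, a complex Banach space with norm $\|\cdot\|_{\mathcal{B}_\alpha}$. Let $g_0(w)=\sum_{j=1}^k a_j+h(w)$, where $k\ge1$, $a_j\in\mathbb{C}$ with $|a_j|>0$, and $h$ is a bounded analytic function on $\mathbb{D}$; $C_{g_0}(f)(z)=\int_0^z\frac{f(w)g_0(w)}{w}\,dw$. An approximate eigenvalue of $T$ is $\lambda$ such that there are unit vectors $x_n$ with $\|(T-\lambda I)x_n\|\to0$. $\mathbb{N}=\{1,2,3,\dots\}$. *)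

(* Defs.v *)
From Stdlib Require Import Reals.
From Coquelicot Require Import Coquelicot.

Definition in_disk (z : C) : Prop := Cmod z < 1.

(* Equality of functions on the disk (elements of function spaces on D are
   represented by functions C -> C whose values off D are irrelevant). *)
Definition eq_on_disk (f g : C -> C) : Prop :=
  forall z, in_disk z -> f z = g z.

Definition analytic_on_disk (f : C -> C) : Prop :=
  forall z, in_disk z -> exists d : C,
    @is_derive C_AbsRing C_NormedModule f z d.

Definition bounded_on_disk (f : C -> C) : Prop :=
  exists M : R, forall z, in_disk z -> Cmod (f z) <= M.

Definition bloch_sup (alpha : R) (f : C -> C) : Rbar :=
  Lub_Rbar (fun r => exists z d, in_disk z /\
     @is_derive C_AbsRing C_NormedModule f z d /\
     r = Rpower (1 - Cmod z ^ 2) alpha * Cmod d).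

(* The alpha-Bloch norm ||f||_{B_alpha} (meaningful when finite). *)
Definition bloch_norm (alpha : R) (f : C -> C) : R := real (bloch_sup alpha f).

Definition in_bloch (alpha : R) (f : C -> C) : Prop :=
  analytic_on_disk f /\ is_finite (bloch_sup alpha f).

Definition in_bloch0 (alpha : R) (f : C -> C) : Prop :=
  in_bloch alpha f /\ f 0%R = 0%R.

(* The generalized Alexander operator
   C_g(f)(z) = int_0^z f(w) g(w) / w dw, integral along the segment [0, z],
   parametrized as w = t z, t in [0,1]. *)
Definition alexander_op (g : C -> C) (f : C -> C) : C -> C :=
  fun z => @RInt C_R_CompleteNormedModule
    (fun t : R => Cmult (Cdiv (Cmult (f (Cmult (RtoC t) z)) (g (Cmult (RtoC t) z)))
                              (Cmult (RtoC t) z)) z) 0 1.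

Definition op_shift (T : (C -> C) -> (C -> C)) (lam : C) (f : C -> C) : C -> C :=
  fun z => Cminus (T f z) (Cmult lam (f z)).

Definition invertible_on (X : (C -> C) -> Prop) (nrm : (C -> C) -> R)
  (T : (C -> C) -> (C -> C)) : Prop :=
  (forall f, X f -> X (T f)) /\
  exists S : (C -> C) -> (C -> C),
    (forall f, X f -> X (S f)) /\
    (forall f, X f -> eq_on_disk (S (T f)) f) /\
    (forall f, X f -> eq_on_disk (T (S f)) f) /\
    (exists K : R, forall f, X f -> nrm (S f) <= K * nrm f).

Definition in_spectrum (X : (C -> C) -> Prop) (nrm : (C -> C) -> R)
  (T : (C -> C) -> (C -> C)) (lam : C) : Prop :=
  ~ invertible_on X nrm (op_shift T lam).

Definition approx_eigenvalue (X : (C -> C) -> Prop) (nrm : (C -> C) -> R)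
  (T : (C -> C) -> (C -> C)) (lam : C) : Prop :=
  exists u : nat -> (C -> C),
    (forall n, X (u n)) /\ (forall n, nrm (u n) = 1) /\
    is_lim_seq (fun n => nrm (op_shift T lam (u n))) 0.

(* Main.v *)
(* Every f in the space factors as f = z E x, where E = exp (int_0^z (g0 w - g0 0) / (lam w) dw)
   is bounded with bounded inverse. In terms of x,
     ((C_g0 - lam) f)' = - lam E (z x' + b x),   b = 1 - g0(0) / lam,
   so everything reduces to the Euler equation z x' + b x = F in the growth space
   sup (1 - |z|^2)^alpha |F| < oo. If b = - m with m a natural number, i.e. lam = g0(0) / (m + 1), then
   x = z^m is a kernel element. Otherwise the equation is uniquely solvable with bounds: for Re b > 1
   the solution is int_0^1 t^(b - 1) F(t z) dt, and peeling off the constant term of x raises b by 1.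
   Finally C_g0 maps the normalised monomial of degree n + 1 to a function of norm O(1 / n), so 0 is an
   approximate eigenvalue.
   Analyticity only means complex differentiability here, so analyticity of f' and the second order
   Taylor bounds rest on Goursat: a form P dx + Q dy with P and Q merely differentiable and P_y = Q_x has
   zero integral around rectangles, and pulling f(w) dw / (w - a) back along the cone that contracts the
   circle to a yields Cauchy's formula. *)

(* Both the norm and the equation [(C_g0 - lam) f = u] can be read off from derivatives, because all
   functions involved vanish at 0. The obstacle is that a bound on [x] in the growth space gives
   none on [x'] in the same space, while [f = z E x] must have a bounded derivative. The way out is
   to write [f' = E ((z x' + b x) + (g0 / lam) x)]: the Euler expression is the given datum, and the
   rest contains [x] only. The threshold [Re b > 1] comes from the kernel: [t^(b - 1)] is then
   continuous at 0 and of modulus at most 1, and the weight decreases with [|z|], so averaging along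
   rays loses nothing. Each shift of [b] costs a division by [z], with a constant independent of
   [F], and a division by [b], which is impossible exactly when the shifts meet 0. The factorization
   needs [lam] nonzero. At 0 the approximate eigenvectors contradict the lower bound that any
   bounded inverse would give. *)
Require Import Defs.
From Stdlib Require Import Reals Lra Lia ClassicalEpsilon.
From Coquelicot Require Import Coquelicot.
Local Open Scope R_scope.

(** * Complex and real differentiation in [C] *)

Notation is_cderive := (@is_derive C_AbsRing C_NormedModule).
Notation C_R := C_R_CompleteNormedModule.

Ltac cring := apply injective_projections; simpl;
  repeat (unfold minus, plus, opp, scal, mult, prod_scal, prod_plus, prod_opp; simpl); ring.

Lemma norm_C_R (z : C) : @norm R_AbsRing C_R z = Cmod z.
Proof.
  unfold norm, Cmod; simpl; unfold prod_norm, norm; simpl; unfold abs; simpl.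
  f_equal. rewrite 2!Rmult_1_r. rewrite <- 2!Rabs_mult.
  rewrite !Rabs_pos_eq; [ring | nra | nra].
Qed.

Lemma norm_pair (u : R * R) :
  @norm R_AbsRing (prod_NormedModule R_AbsRing R_NormedModule R_NormedModule) u = Cmod u.
Proof. exact (norm_C_R u). Qed.

(** [C] carries two uniform structures: the product structure of [C_R], used for real curves and
    integrals, and that of [C_AbsRing], used for complex derivatives. This lemma and the next reduce
    both to [Cmod] discs. *)
Lemma locally_C_Cmod (z : C) (P : C -> Prop) :
  @locally C_R z P <-> exists d : posreal, forall w, Cmod (w - z)%C < d -> P w.
Proof.
  split.
  - intros [d Hd]. exists d. intros w Hw. apply Hd.
    apply (@norm_compat1 R_AbsRing C_R).
    rewrite norm_C_R. exact Hw.
  - intros [d Hd]. apply (@locally_le_locally_norm R_AbsRing C_R).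
    exists d. intros w Hw. apply Hd. rewrite <- norm_C_R. exact Hw.
Qed.

Lemma locally_C_AbsRing_Cmod (z : C) (P : C -> Prop) :
  @locally (AbsRing_UniformSpace C_AbsRing) z P <->
  exists d : posreal, forall w, Cmod (w - z)%C < d -> P w.
Proof.
  split.
  - intros [d Hd]. exists d. intros w Hw. apply Hd. exact Hw.
  - intros [d Hd]. exists d. intros w Hw. apply Hd. exact Hw.
Qed.

Lemma is_cderive_iff (f : C -> C) (z d : C) :
  is_cderive f z d <->
  forall eps : posreal, exists delta : posreal, forall w,
    Cmod (w - z)%C < delta ->
    Cmod (f w - f z - d * (w - z))%C <= eps * Cmod (w - z)%C.
Proof.
  split.
  - intros [_ H] eps.
    specialize (H z (fun P HP => HP) eps).
    apply locally_C_AbsRing_Cmod in H. destruct H as [de Hd]. exists de.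
    intros w Hw. specialize (Hd w Hw).
    replace (f w - f z - d * (w - z))%C with
       (minus (minus (f w) (f z)) (scal (minus w z) d)). exact Hd.
    unfold minus, plus, opp, scal; simpl. unfold mult; simpl. ring.
  - intros H. split. apply is_linear_scal_l.
    intros x Hx eps.
    (* [filterdiff] quantifies over every limit of the filter; limits are unique, so only [z]
       remains. *)
    assert (E : z = x).
    { apply (@is_filter_lim_locally_unique C_AbsRing C_NormedModule).
      intros P HP. apply locally_C, Hx. apply locally_C. exact HP. }
    subst x.
    apply locally_C_AbsRing_Cmod. destruct (H eps) as [de Hd]. exists de.
    intros w Hw. specialize (Hd w Hw).
    replace (f w - f z - d * (w - z))%C with
       (minus (minus (f w) (f z)) (@scal C_AbsRing C_NormedModule (minus w z) d)) in Hd. exact Hd.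
    unfold minus, plus, opp, scal; simpl. unfold mult; simpl. ring.
Qed.

Lemma is_linear_Cmult_r (d : C) :
  @is_linear R_AbsRing C_R C_R (fun h => Cmult h d).
Proof.
  split.
  - intros x y. cring.
  - intros k x. cring.
  - exists (Cmod d + 1). split. pose proof (Cmod_ge_0 d); lra.
    intros x. rewrite !norm_C_R, Cmod_mult. pose proof (Cmod_ge_0 d); pose proof (Cmod_ge_0 x); nra.
Qed.

(** Bridge from complex derivatives to real curves and to functions on the plane: the real
    differential is multiplication by [d]. *)
Lemma is_cderive_filterdiff (f : C -> C) (z d : C) :
  is_cderive f z d ->
  @filterdiff R_AbsRing C_R C_R f (locally z) (fun h => Cmult h d).
Proof.
  intros H. split. apply is_linear_Cmult_r.
  intros x Hx eps.
  assert (E : z = x) by (apply (@is_filter_lim_locally_unique R_AbsRing C_R); exact Hx).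
  subst x. apply locally_C_Cmod. destruct (proj1 (is_cderive_iff f z d) H eps) as [de Hd]. exists de.
  intros w Hw. specialize (Hd w Hw). rewrite !norm_C_R.
  replace (f w - f z - d * (w - z))%C with
    (minus (minus (f w) (f z)) (minus w z * d)%C) in Hd. exact Hd.
  cring.
Qed.

Lemma filterdiff_Cmult (x y : C) :
  @filterdiff R_AbsRing (prod_NormedModule R_AbsRing C_R C_R) C_R
    (fun t => Cmult (fst t) (snd t)) (locally (x, y))
    (fun t => Cplus (Cmult (fst t) y) (Cmult (snd t) x)).
Proof.
  split.
  - apply (@is_linear_comp R_AbsRing (prod_NormedModule R_AbsRing C_R C_R) (prod_NormedModule R_AbsRing C_R C_R) C_R
      (fun t => (Cmult (fst t) y, Cmult (snd t) x)) (fun t => plus (fst t) (snd t))).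
    + apply (@is_linear_prod R_AbsRing (prod_NormedModule R_AbsRing C_R C_R) C_R C_R).
      * apply (@is_linear_comp R_AbsRing (prod_NormedModule R_AbsRing C_R C_R) C_R C_R (fun t => fst t) (fun h => Cmult h y)).
        apply (@is_linear_fst R_AbsRing C_R C_R). apply is_linear_Cmult_r.
      * apply (@is_linear_comp R_AbsRing (prod_NormedModule R_AbsRing C_R C_R) C_R C_R (fun t => snd t) (fun h => Cmult h x)).
        apply (@is_linear_snd R_AbsRing C_R C_R). apply is_linear_Cmult_r.
    + apply (@is_linear_plus R_AbsRing C_R).
  - intros p Hp eps.
    assert (E : (x, y) = p) by
      (apply (@is_filter_lim_locally_unique R_AbsRing (prod_NormedModule R_AbsRing C_R C_R)); exact Hp).
    subst p.
    apply (@locally_le_locally_norm R_AbsRing (prod_NormedModule R_AbsRing C_R C_R)).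
    (* The remainder is exactly [(u - x) * (v - y)], at most the square of the distance, so the
       radius [eps] itself suffices. *)
    exists eps. intros [u v] Huv. unfold ball_norm in Huv.
    assert (N : forall u v : C, @norm R_AbsRing (prod_NormedModule R_AbsRing C_R C_R) (u,v) =
       sqrt (Cmod u ^ 2 + Cmod v ^ 2)).
    { intros. unfold norm; simpl. unfold prod_norm; simpl fst; simpl snd.
      now rewrite <- !norm_C_R. }
    change (@norm R_AbsRing (prod_NormedModule R_AbsRing C_R C_R) ((u - x)%C, (v - y)%C) < eps) in Huv.
    change (@minus (prod_NormedModule R_AbsRing C_R C_R) (u,v) (x,y)) with ((u - x)%C, (v - y)%C).
    rewrite N in *.
    simpl fst; simpl snd. rewrite norm_C_R.
    match goal with |- Cmod ?e <= _ => replace e with ((u - x) * (v - y))%C by cring end.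
    rewrite Cmod_mult. pose proof (Cmod_ge_0 (u-x)%C). pose proof (Cmod_ge_0 (v-y)%C).
    set (a := Cmod (u-x)%C) in *. set (b := Cmod (v-y)%C) in *.
    assert (a <= sqrt (a^2+b^2)).
    { rewrite <- (sqrt_pow2 a) at 1 by lra. apply sqrt_le_1_alt. nra. }
    assert (b <= sqrt (a^2+b^2)).
    { rewrite <- (sqrt_pow2 b) at 1 by lra. apply sqrt_le_1_alt. nra. }
    nra.
Qed.
Lemma is_cderive_AbsRing (f : C -> C) (z d : C) :
  is_cderive f z d <-> @is_derive C_AbsRing (AbsRing_NormedModule C_AbsRing) f z d.
Proof.
  split; intros [_ H]; (split; [ apply is_linear_scal_l | exact H ]).
Qed.

Lemma is_cderive_mult (f g : C -> C) (z df dg : C) :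
  is_cderive f z df -> is_cderive g z dg ->
  is_cderive (fun w => f w * g w)%C z (df * g z + f z * dg)%C.
Proof.
  rewrite !is_cderive_AbsRing. intros Hf Hg.
  apply (@is_derive_mult C_AbsRing f g z df dg Hf Hg Cmult_comm).
Qed.

Lemma is_cderive_comp (f g : C -> C) (z df dg : C) :
  is_cderive f (g z) df -> is_cderive g z dg ->
  is_cderive (fun w => f (g w)) z (dg * df)%C.
Proof.
  intros Hf Hg. apply is_cderive_AbsRing in Hg.
  exact (@is_derive_comp C_AbsRing C_NormedModule f g z df dg Hf Hg).
Qed.

Lemma is_cderive_plus (f g : C -> C) (z df dg : C) :
  is_cderive f z df -> is_cderive g z dg ->
  is_cderive (fun w => f w + g w)%C z (df + dg)%C.
Proof. exact (@is_derive_plus C_AbsRing C_NormedModule f g z df dg). Qed.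

Lemma is_cderive_minus (f g : C -> C) (z df dg : C) :
  is_cderive f z df -> is_cderive g z dg ->
  is_cderive (fun w => f w - g w)%C z (df - dg)%C.
Proof. exact (@is_derive_minus C_AbsRing C_NormedModule f g z df dg). Qed.

Lemma is_cderive_const (c z : C) : is_cderive (fun _ => c) z (RtoC 0).
Proof. exact (@is_derive_const C_AbsRing C_NormedModule c z). Qed.

Lemma is_cderive_id (z : C) : is_cderive (fun w => w) z (RtoC 1).
Proof. apply is_cderive_AbsRing. exact (@is_derive_id C_AbsRing z). Qed.

Lemma is_cderive_eq (f : C -> C) (z d d' : C) :
  is_cderive f z d -> d = d' -> is_cderive f z d'.
Proof. now intros H <-. Qed.

Lemma is_cderive_scal (k : C) (f : C -> C) (z d : C) :
  is_cderive f z d -> is_cderive (fun w => k * f w)%C z (k * d)%C.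
Proof.
  intros H. eapply is_cderive_eq.
  apply (is_cderive_mult _ _ _ _ _ (is_cderive_const k z) H). ring.
Qed.

Lemma is_cderive_ext_loc (f g : C -> C) (z d : C) (r : R) :
  0 < r -> (forall w, Cmod (w - z)%C < r -> f w = g w) ->
  is_cderive f z d -> is_cderive g z d.
Proof.
  intros Hr E. apply is_derive_ext_loc. exists (mkposreal r Hr). exact E.
Qed.

Lemma is_cderive_unique (f : C -> C) (z d d' : C) :
  is_cderive f z d -> is_cderive f z d' -> d = d'.
Proof.
  intros H H'. apply is_C_derive_unique in H, H'. congruence.
Qed.

(** Quadratic remainders pass through integrals as plain inequalities, so derivatives of Cauchy and
    radial integrals are obtained in this form. The sign of [M] is arbitrary, hence [Rabs M + 1] in
    the radius. *)
Lemma is_cderive_of_quadratic (f : C -> C) (z d : C) (r M : R) :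
  0 < r ->
  (forall w, Cmod (w - z)%C < r -> Cmod (f w - f z - d * (w - z))%C <= M * Cmod (w - z)%C ^ 2) ->
  is_cderive f z d.
Proof.
  intros Hr H. apply is_cderive_iff. intros eps.
  assert (HM : 0 < Rabs M + 1) by (pose proof (Rabs_pos M); lra).
  assert (Hd : 0 < Rmin r (eps / (Rabs M + 1))).
  { apply Rmin_pos. exact Hr. apply Rdiv_lt_0_compat. apply cond_pos. exact HM. }
  exists (mkposreal _ Hd). simpl. intros w Hw.
  eapply Rle_trans. apply H. eapply Rlt_le_trans. exact Hw. apply Rmin_l.
  assert (Hw' : Cmod (w - z)%C < eps / (Rabs M + 1)) by (eapply Rlt_le_trans; [exact Hw | apply Rmin_r]).
  pose proof (Cmod_ge_0 (w - z)%C) as Hp. pose proof (Rle_abs M).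
  assert ((Rabs M + 1) * Cmod (w - z)%C <= eps).
  { apply Rlt_le. replace (pos eps) with ((Rabs M + 1) * (eps / (Rabs M + 1))) by (field; lra).
    now apply Rmult_lt_compat_l. }
  nra.
Qed.

Lemma Cmod_minus_ge (z w : C) : Cmod z - Cmod w <= Cmod (z - w)%C.
Proof.
  pose proof (Cmod_triangle (z - w)%C w).
  replace (z - w + w)%C with z in H by ring. lra.
Qed.

Lemma Cmod_minus_sym (z w : C) : Cmod (z - w)%C = Cmod (w - z)%C.
Proof. rewrite <- Cmod_opp. f_equal. ring. Qed.

Lemma is_cderive_inv (z : C) : z <> RtoC 0 -> is_cderive Cinv z (- / (z * z))%C.
Proof.
  intros Hz. assert (P : 0 < Cmod z) by now apply Cmod_gt_0.
  (* The remainder is [(w - z)^2 / (z^2 w)], and [|w| > |z| / 2] on this disc. *)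
  apply (is_cderive_of_quadratic _ _ _ (Cmod z / 2) (2 / Cmod z ^ 3)). lra.
  intros w Hw.
  assert (Q : Cmod z / 2 < Cmod w).
  { pose proof (Cmod_minus_ge z w). rewrite Cmod_minus_sym in Hw. lra. }
  assert (w <> RtoC 0) by (apply Cmod_gt_0; lra).
  replace (/ w - / z - - / (z * z) * (w - z))%C with ((w - z) * (w - z) * / (z * z * w))%C by (field; auto).
  rewrite !Cmod_mult, Cmod_inv, !Cmod_mult by (repeat apply Cmult_neq_0; auto).
  replace (2 / Cmod z ^ 3 * Cmod (w - z) ^ 2) with (Cmod (w - z) * Cmod (w - z) * (2 / Cmod z ^3)) by ring.
  apply Rmult_le_compat_l. apply Rmult_le_pos; apply Cmod_ge_0.
  replace (2 / Cmod z ^ 3) with (/ (Cmod z * Cmod z * (Cmod z / 2))) by (field; lra).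
  apply Rinv_le_contravar. repeat apply Rmult_lt_0_compat; lra.
  apply Rmult_le_compat_l; nra.
Qed.

Lemma is_cderive_continuous (f : C -> C) (z d : C) :
  is_cderive f z d -> @continuous C_R C_R f z.
Proof.
  intros H. apply (@filterdiff_continuous R_AbsRing C_R C_R).
  exists (fun h => Cmult h d). now apply is_cderive_filterdiff.
Qed.

Notation is_rderive := (@is_derive R_AbsRing C_R).

Lemma is_rderive_comp (f : C -> C) (g : R -> C) (t : R) (df dg : C) :
  is_cderive f (g t) df -> is_rderive g t dg ->
  is_rderive (fun s => f (g s)) t (dg * df)%C.
Proof.
  intros Hf Hg. apply is_cderive_filterdiff in Hf.
  pose proof (@filterdiff_comp' R_AbsRing R_NormedModule C_R C_R g f t _ _ Hg Hf) as H.
  eapply filterdiff_ext_lin. exact H. intros y. simpl. cring.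
Qed.

Lemma is_rderive_mult (f g : R -> C) (t : R) (df dg : C) :
  is_rderive f t df -> is_rderive g t dg ->
  is_rderive (fun s => f s * g s)%C t (df * g t + f t * dg)%C.
Proof.
  intros Hf Hg.
  pose proof (@filterdiff_comp'_2 R_AbsRing R_NormedModule C_R C_R C_R f g Cmult t _ _
     (fun u v => u * g t + v * f t)%C Hf Hg (filterdiff_Cmult (f t) (g t))) as H.
  eapply filterdiff_ext_lin. exact H. intros y. simpl. cring.
Qed.

Lemma is_rderive_continuous (f : R -> C) (t : R) (d : C) :
  is_rderive f t d -> @continuous R_UniformSpace C_R f t.
Proof. intros H. apply (@ex_derive_continuous R_AbsRing C_R). now exists d. Qed.

Lemma is_rderive_pair (u v : R -> R) (t du dv : R) :
  is_derive u t du -> is_derive v t dv ->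
  is_rderive (fun s => (u s, v s)) t (du, dv).
Proof.
  intros Hu Hv.
  pose proof (@filterdiff_comp'_2 R_AbsRing R_NormedModule R_NormedModule R_NormedModule C_R u v pair t _ _
     pair Hu Hv) as H.
  eapply filterdiff_ext_lin. apply H.
  - eapply filterdiff_ext_lin. eapply filterdiff_ext. 2: apply filterdiff_id.
    intros [a b]; reflexivity. intros [a b]; reflexivity.
  - intros y. simpl. cring.
Qed.

Lemma continuous_Cmult (T : UniformSpace) (f g : T -> C) (t : T) :
  @continuous T C_R f t -> @continuous T C_R g t ->
  @continuous T C_R (fun s => f s * g s)%C t.
Proof.
  intros Hf Hg.
  apply (@continuous_comp_2 T C_R C_R C_R f g Cmult t Hf Hg).
  apply (@filterdiff_continuous R_AbsRing (prod_NormedModule R_AbsRing C_R C_R) C_R).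
  eexists. apply filterdiff_Cmult.
Qed.

(** * Goursat's theorem in Green form *)

Lemma functional_choice (A B : Type) (P : A -> B -> Prop) :
  (forall x, exists y, P x y) -> exists f : A -> B, forall x, P x (f x).
Proof.
  intros H. exists (fun x => proj1_sig (constructive_indefinite_description _ (H x))).
  intros x. apply proj2_sig.
Qed.

(** [B] will be the defect of Green's identity. Additivity under quartering leaves some quarter with
    at least a quarter of [|B|], whence [4 ^ n]; the common point is where differentiability will be
    applied. *)
Lemma nested_rectangles (B : R -> R -> R -> R -> R) (a b c d : R) :
  a < b -> c < d ->
  (forall x0 x1 y0 y1, a <= x0 < x1 -> x1 <= b -> c <= y0 < y1 -> y1 <= d ->
     B x0 x1 y0 y1 =
       B x0 ((x0 + x1) / 2) y0 ((y0 + y1) / 2) + B ((x0 + x1) / 2) x1 y0 ((y0 + y1) / 2) +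
       B x0 ((x0 + x1) / 2) ((y0 + y1) / 2) y1 + B ((x0 + x1) / 2) x1 ((y0 + y1) / 2) y1) ->
  exists x y, forall n : nat, exists x0 x1 y0 y1,
    a <= x0 <= x /\ x <= x1 <= b /\ c <= y0 <= y /\ y <= y1 <= d /\
    x1 - x0 = (b - a) / 2 ^ n /\ y1 - y0 = (d - c) / 2 ^ n /\
    Rabs (B a b c d) <= 4 ^ n * Rabs (B x0 x1 y0 y1).
Proof.
  intros Hab Hcd Hsub.
  set (w := fun n : nat => (b - a) / 2 ^ n). set (h := fun n : nat => (d - c) / 2 ^ n).
  assert (Hw : forall n, 0 < w n) by (intros n; apply Rdiv_lt_0_compat; [lra | apply pow_lt; lra]).
  assert (Hh : forall n, 0 < h n) by (intros n; apply Rdiv_lt_0_compat; [lra | apply pow_lt; lra]).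
  assert (HwS : forall n, w n = 2 * w (S n)).
  { intros n. unfold w. simpl. field. apply pow_nonzero. lra. }
  assert (HhS : forall n, h n = 2 * h (S n)).
  { intros n. unfold h. simpl. field. apply pow_nonzero. lra. }
  (* A rectangle of generation [n] is recorded by its lower left corner, since its sides are [w n]
     and [h n]. *)
  set (Good := fun (n : nat) (p : R * R) =>
    a <= fst p /\ fst p + w n <= b /\ c <= snd p /\ snd p + h n <= d /\
    Rabs (B a b c d) <= 4 ^ n * Rabs (B (fst p) (fst p + w n) (snd p) (snd p + h n))).
  set (Next := fun (n : nat) (p q : R * R) =>
    (fst q = fst p \/ fst q = fst p + w (S n)) /\ (snd q = snd p \/ snd q = snd p + h (S n))).
  (* The implication sits under the existential so that choice yields a total successor function. *)
  assert (Step : forall n p, exists q, Good n p -> Good (S n) q /\ Next n p q).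
  { intros n [x y]. destruct (classic (Good n (x, y))) as [G|G].
    2: { exists (x, y). now intros. }
    destruct G as (G1 & G2 & G3 & G4 & G5). simpl in *.
    pose proof (Hw (S n)). pose proof (Hh (S n)).
    rewrite (Hsub x (x + w n) y (y + h n)) in G5
      by (rewrite ?(HwS n), ?(HhS n) in *; lra).
    replace ((x + (x + w n)) / 2) with (x + w (S n)) in G5 by (pose proof (HwS n); lra).
    replace ((y + (y + h n)) / 2) with (y + h (S n)) in G5 by (pose proof (HhS n); lra).
    assert (E1 : x + w n = x + w (S n) + w (S n)) by (pose proof (HwS n); lra).
    assert (E2 : y + h n = y + h (S n) + h (S n)) by (pose proof (HhS n); lra).
    rewrite E1, E2 in *.
    set (M := Rabs (B a b c d)) in *.
    match type of G5 with M <= _ * Rabs (?e1 + ?e2 + ?e3 + ?e4) =>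
      set (B1 := e1) in *; set (B2 := e2) in *; set (B3 := e3) in *; set (B4 := e4) in * end.
    assert (P : 0 < 4 ^ n) by (apply pow_lt; lra).
    assert (T : Rabs (B1 + B2 + B3 + B4) <= Rabs B1 + Rabs B2 + Rabs B3 + Rabs B4).
    { eapply Rle_trans. apply Rabs_triang. apply Rplus_le_compat_r.
      eapply Rle_trans. apply Rabs_triang. apply Rplus_le_compat_r. apply Rabs_triang. }
    assert (D : M <= 4 ^ S n * Rabs B1 \/ M <= 4 ^ S n * Rabs B2 \/
                M <= 4 ^ S n * Rabs B3 \/ M <= 4 ^ S n * Rabs B4).
    { simpl. apply NNPP. intros N. apply not_or_and in N as [N1 N].
      apply not_or_and in N as [N2 N]. apply not_or_and in N as [N3 N4].
      apply Rnot_le_lt in N1, N2, N3, N4. apply (Rmult_le_compat_l (4 ^ n)) in T; lra. }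
    destruct D as [D|[D|[D|D]]];
      [ exists (x, y) | exists (x + w (S n), y) | exists (x, y + h (S n))
      | exists (x + w (S n), y + h (S n)) ]; intros _; unfold Good, Next; simpl fst; simpl snd;
      (split; [repeat split; try lra; exact D | split; auto]). }
  destruct (functional_choice _ _ (fun np q => Good (fst np) (snd np) -> Good (S (fst np)) q /\ Next (fst np) (snd np) q)
     (fun np => Step (fst np) (snd np))) as [nxt Hnxt].
  set (s := fix s n := match n with O => (a, c) | S n => nxt (n, s n) end).
  assert (HG : forall n, Good n (s n)).
  { induction n as [|n IH].
    - unfold Good, w, h; simpl. replace (a + (b - a) / 1) with b by field.
      replace (c + (d - c) / 1) with d by field. repeat split; lra.
    - exact (proj1 (Hnxt (n, s n) IH)). }
  assert (HN : forall n, Next n (s n) (s (S n))).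
  { intros n. exact (proj2 (Hnxt (n, s n) (HG n))). }
  (* Nested intervals: left ends increase, right ends decrease and lengths tend to 0, so the limit
     of the left ends lies in every interval. *)
  assert (Lim : forall (u v : nat -> R) (M K : R), (forall n, 0 < v n) -> (forall n, v n = 2 * v (S n)) ->
     (forall n, v n = K / 2 ^ n) ->
     (forall n, u (S n) = u n \/ u (S n) = u n + v (S n)) -> (forall n, u n + v n <= M) ->
     exists x, forall n, u n <= x <= u n + v n).
  { intros u v M K V0 V1 V2 U1 U2.
    assert (I : forall n, u n <= u (S n)) by (intros n; pose proof (V0 (S n)); destruct (U1 n); lra).
    destruct (ex_finite_lim_seq_incr u M I) as [x Hx].
    { intros n. pose proof (V0 n). pose proof (U2 n). lra. }
    exists x. intros n. split. now apply is_lim_seq_incr_compare.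
    apply (is_lim_seq_decr_compare (fun n => u n + v n)).
    - replace (Finite x) with (Finite (x + K * 0)) by (f_equal; ring).
      apply is_lim_seq_plus'. exact Hx.
      apply (is_lim_seq_ext (fun n => K * (/2) ^ n)).
      { intros m. rewrite V2. unfold Rdiv. now rewrite pow_inv. }
      apply (is_lim_seq_scal_l _ K 0). apply is_lim_seq_geom. rewrite Rabs_pos_eq; lra.
    - intros m. pose proof (V0 (S m)). rewrite (V1 m). destruct (U1 m); lra. }
  destruct (Lim (fun n => fst (s n)) w b (b - a)) as [x Hx]; auto.
  { intros n. apply HN. } { intros n. apply HG. }
  destruct (Lim (fun n => snd (s n)) h d (d - c)) as [y Hy]; auto.
  { intros n. apply HN. } { intros n. apply HG. }
  exists x, y. intros n. exists (fst (s n)), (fst (s n) + w n), (snd (s n)), (snd (s n) + h n).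
  destruct (HG n) as (G1 & G2 & G3 & G4 & G5). specialize (Hx n). specialize (Hy n). simpl in *.
  unfold w in *; unfold h in *.
  repeat split; try lra.
Qed.

Lemma differentiable_pt_lim_continuous_l (P : R -> R -> R) (x y px py : R) :
  differentiable_pt_lim P x y px py -> continuous (fun u => P u y) x.
Proof.
  intros H. apply (@ex_derive_continuous R_AbsRing R_NormedModule). eexists. apply is_derive_Reals.
  apply (derivable_pt_lim_comp_2d P (fun u => u) (fun _ => y) x _ _ 1 0 H).
  apply derivable_pt_lim_id. apply derivable_pt_lim_const.
Qed.

Lemma differentiable_pt_lim_swap (P : R -> R -> R) (x y px py : R) :
  differentiable_pt_lim P x y px py -> differentiable_pt_lim (fun v u => P u v) y x py px.
Proof.
  intros H eps. destruct (H eps) as [de Hd]. exists de. intros v u Hv Hu.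
  specialize (Hd u v Hu Hv). rewrite Rmax_comm, (Rplus_comm (py * _)). exact Hd.
Qed.

Lemma RInt_near_const (f : R -> R) (a b c m : R) :
  a <= b -> (forall t, a <= t <= b -> continuous f t) ->
  (forall t, a <= t <= b -> Rabs (f t - c) <= m) ->
  Rabs (RInt f a b - c * (b - a)) <= m * (b - a).
Proof.
  intros Hab Hc Hm.
  assert (I : ex_RInt f a b).
  { apply (@ex_RInt_continuous R_CompleteNormedModule). rewrite Rmin_left, Rmax_right by lra. exact Hc. }
  replace (RInt f a b - c * (b - a)) with (RInt (fun t => f t - c) a b).
  2: { rewrite (RInt_minus f (fun _ => c)) by (auto; apply ex_RInt_const).
       rewrite RInt_const. unfold minus, plus, opp, scal; simpl; unfold mult; simpl. ring. }
  rewrite Rmult_comm. apply abs_RInt_le_const; auto.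
  apply (ex_RInt_minus f (fun _ => c)); auto. apply ex_RInt_const.
Qed.

(** Between two opposite sides the terms [P x y] and [px * (u - x)] of the linear approximation
    cancel; only [py * (y1 - y0)] survives. With the variables swapped, the same estimate serves
    [Q]. *)
Lemma opposite_sides_estimate (P : R -> R -> R) (x y px py eps delta x0 x1 y0 y1 : R) :
  0 <= eps ->
  (forall u v, Rabs (u - x) < delta -> Rabs (v - y) < delta ->
     Rabs (P u v - P x y - (px * (u - x) + py * (v - y))) <= eps * Rmax (Rabs (u - x)) (Rabs (v - y))) ->
  x0 <= x <= x1 -> y0 <= y <= y1 -> x1 - x0 < delta -> y1 - y0 < delta ->
  (forall u, x0 <= u <= x1 -> continuous (fun u => P u y0) u) ->
  (forall u, x0 <= u <= x1 -> continuous (fun u => P u y1) u) ->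
  Rabs (RInt (fun u => P u y1) x0 x1 - RInt (fun u => P u y0) x0 x1 - py * (y1 - y0) * (x1 - x0)) <=
  2 * eps * ((x1 - x0) + (y1 - y0)) * (x1 - x0).
Proof.
  intros He H Hx Hy Dx Dy C0 C1.
  assert (I0 : ex_RInt (fun u => P u y0) x0 x1).
  { apply (@ex_RInt_continuous R_CompleteNormedModule). rewrite Rmin_left, Rmax_right by lra. exact C0. }
  assert (I1 : ex_RInt (fun u => P u y1) x0 x1).
  { apply (@ex_RInt_continuous R_CompleteNormedModule). rewrite Rmin_left, Rmax_right by lra. exact C1. }
  rewrite <- (RInt_minus (fun u => P u y1) (fun u => P u y0)) by auto.
  apply RInt_near_const. lra.
  { intros t Ht. apply (continuous_minus (fun u => P u y1) (fun u => P u y0)); auto. }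
  intros u Hu. unfold minus, plus, opp; simpl.
  assert (Rabs (u - x) <= x1 - x0) by (apply Rabs_le; lra).
  assert (Rabs (y1 - y) <= y1 - y0) by (apply Rabs_le; lra).
  assert (Rabs (y0 - y) <= y1 - y0) by (apply Rabs_le; lra).
  pose proof (H u y1 ltac:(lra) ltac:(lra)) as K1. pose proof (H u y0 ltac:(lra) ltac:(lra)) as K0.
  assert (M1 : Rmax (Rabs (u - x)) (Rabs (y1 - y)) <= (x1 - x0) + (y1 - y0)) by (apply Rmax_lub; lra).
  assert (M0 : Rmax (Rabs (u - x)) (Rabs (y0 - y)) <= (x1 - x0) + (y1 - y0)) by (apply Rmax_lub; lra).
  apply (Rmult_le_compat_l eps) in M1, M0; auto.
  replace (P u y1 + - P u y0 - py * (y1 - y0)) with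
    ((P u y1 - P x y - (px * (u - x) + py * (y1 - y))) - (P u y0 - P x y - (px * (u - x) + py * (y0 - y)))) by ring.
  eapply Rle_trans. apply Rabs_triang. rewrite Rabs_Ropp. lra.
Qed.

(* Goursat's subdivision argument: no continuity of the partial derivatives is assumed. *)
Lemma green_rectangle (P Q : R -> R -> R) (a b c d : R) :
  a < b -> c < d ->
  (forall x y, a <= x <= b -> c <= y <= d -> exists px k qy,
     differentiable_pt_lim P x y px k /\ differentiable_pt_lim Q x y k qy) ->
  RInt (fun x => P x d) a b - RInt (fun x => P x c) a b =
  RInt (fun y => Q b y) c d - RInt (fun y => Q a y) c d.
Proof.
  intros Hab Hcd H.
  assert (CP : forall x y, a <= x <= b -> c <= y <= d -> continuous (fun u => P u y) x).
  { intros x y Hx Hy. destruct (H x y Hx Hy) as (px & k & qy & HP & _).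
    eapply differentiable_pt_lim_continuous_l, HP. }
  assert (CQ : forall x y, a <= x <= b -> c <= y <= d -> continuous (fun v => Q x v) y).
  { intros x y Hx Hy. destruct (H x y Hx Hy) as (px & k & qy & _ & HQ).
    apply (differentiable_pt_lim_continuous_l (fun v u => Q u v) y x qy k).
    now apply differentiable_pt_lim_swap. }
  assert (IP : forall y x0 x1, c <= y <= d -> a <= x0 <= x1 -> x1 <= b -> ex_RInt (fun u => P u y) x0 x1).
  { intros y x0 x1 Hy Hx0 Hx1. apply (@ex_RInt_continuous R_CompleteNormedModule).
    rewrite Rmin_left, Rmax_right by lra. intros z Hz. apply CP; lra. }
  assert (IQ : forall x y0 y1, a <= x <= b -> c <= y0 <= y1 -> y1 <= d -> ex_RInt (fun v => Q x v) y0 y1).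
  { intros x y0 y1 Hx Hy0 Hy1. apply (@ex_RInt_continuous R_CompleteNormedModule).
    rewrite Rmin_left, Rmax_right by lra. intros z Hz. apply CQ; lra. }
  set (B := fun x0 x1 y0 y1 =>
    (RInt (fun x => P x y1) x0 x1 - RInt (fun x => P x y0) x0 x1) -
    (RInt (fun y => Q x1 y) y0 y1 - RInt (fun y => Q x0 y) y0 y1)).
  enough (E : B a b c d = 0) by (unfold B in E; lra).
  apply NNPP. intros NE.
  destruct (nested_rectangles B a b c d Hab Hcd) as (x & y & Hxy).
  { intros x0 x1 y0 y1 X0 X1 Y0 Y1. unfold B.
    set (xm := (x0 + x1) / 2). set (ym := (y0 + y1) / 2).
    assert (x0 < xm < x1) by (unfold xm; lra). assert (y0 < ym < y1) by (unfold ym; lra).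
    rewrite <- (RInt_Chasles (fun x => P x y1) x0 xm x1) by (apply IP; lra).
    rewrite <- (RInt_Chasles (fun x => P x y0) x0 xm x1) by (apply IP; lra).
    rewrite <- (RInt_Chasles (fun y => Q x1 y) y0 ym y1) by (apply IQ; lra).
    rewrite <- (RInt_Chasles (fun y => Q x0 y) y0 ym y1) by (apply IQ; lra).
    unfold plus; simpl. ring. }
  assert (Hx : a <= x <= b) by (destruct (Hxy O) as (? & ? & ? & ? & ?); lra).
  assert (Hy : c <= y <= d) by (destruct (Hxy O) as (? & ? & ? & ? & ?); lra).
  destruct (H x y Hx Hy) as (px & k & qy & HP & HQ). apply differentiable_pt_lim_swap in HQ.
  set (L := (b - a) + (d - c)). assert (HL : 0 < L) by (unfold L; lra).
  set (e := Rabs (B a b c d)). assert (He : 0 < e) by now apply Rabs_pos_lt.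
  (* Chosen so that [4 ^ n] times the error [2 eps (L / 2 ^ n)^2] is [e / 2], below the lower bound
     [e] kept by the subdivision. *)
  assert (Heps : 0 < e / (4 * L * L)) by (apply Rdiv_lt_0_compat; [lra | nra]).
  destruct (HP (mkposreal _ Heps)) as [d1 H1]. destruct (HQ (mkposreal _ Heps)) as [d2 H2].
  simpl in H1, H2. set (eps := e / (4 * L * L)) in *.
  destruct (pow_lt_1_zero (/2) ltac:(rewrite Rabs_pos_eq; lra) (Rmin d1 d2 / L)) as [n Hn].
  { apply Rdiv_lt_0_compat; auto. apply Rmin_pos; apply cond_pos. }
  specialize (Hn n (le_n n)).
  destruct (Hxy n) as (x0 & x1 & y0 & y1 & X0 & X1 & Y0 & Y1 & W & V & Bn).
  assert (Pn : 0 < 2 ^ n) by (apply pow_lt; lra).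
  assert (Ln : L / 2 ^ n < Rmin d1 d2).
  { rewrite pow_inv, Rabs_pos_eq in Hn by (apply Rlt_le, Rinv_0_lt_compat; lra).
    apply (Rmult_lt_compat_l L) in Hn; auto.
    replace (L * (Rmin d1 d2 / L)) with (Rmin d1 d2) in Hn by (field; lra). exact Hn. }
  assert (S : (x1 - x0) + (y1 - y0) = L / 2 ^ n) by (rewrite W, V; unfold L; field; lra).
  pose proof (Rmin_l d1 d2). pose proof (Rmin_r d1 d2).
  assert (0 < x1 - x0) by (rewrite W; apply Rdiv_lt_0_compat; lra).
  assert (0 < y1 - y0) by (rewrite V; apply Rdiv_lt_0_compat; lra).
  pose proof (opposite_sides_estimate P x y px k eps d1 x0 x1 y0 y1 ltac:(lra) H1 ltac:(lra) ltac:(lra)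
    ltac:(lra) ltac:(lra) ltac:(intros; apply CP; lra) ltac:(intros; apply CP; lra)) as E1.
  pose proof (opposite_sides_estimate (fun v u => Q u v) y x qy k eps d2 y0 y1 x0 x1 ltac:(lra) H2 ltac:(lra) ltac:(lra)
    ltac:(lra) ltac:(lra) ltac:(intros; apply CQ; lra) ltac:(intros; apply CQ; lra)) as E2.
  simpl in E2.
  (* The main terms, [k] times the area from each of [P_y] and [Q_x], cancel. *)
  assert (E : Rabs (B x0 x1 y0 y1) <= 2 * eps * (L / 2 ^ n) * (L / 2 ^ n)).
  { rewrite <- S. unfold B.
    replace (2 * eps * (x1 - x0 + (y1 - y0)) * (x1 - x0 + (y1 - y0))) with
      (2 * eps * (x1 - x0 + (y1 - y0)) * (x1 - x0) + 2 * eps * (y1 - y0 + (x1 - x0)) * (y1 - y0)) by ring.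
    eapply Rle_trans. 2: apply Rplus_le_compat; [exact E1 | exact E2].
    rewrite <- (Rabs_Ropp (RInt (fun u => Q x1 u) y0 y1 - _ - _)).
    eapply Rle_trans. 2: apply Rabs_triang. right. f_equal. ring. }
  apply (Rmult_le_compat_l (4 ^ n)) in E. 2: apply pow_le; lra.
  replace 4 with (2 * 2) in E at 2 by ring. rewrite Rpow_mult_distr in E.
  replace (2 ^ n * 2 ^ n * (2 * eps * (L / 2 ^ n) * (L / 2 ^ n))) with (e / 2) in E.
  2: { unfold eps. field. split; lra. }
  fold e in Bn. lra.
Qed.

(** * Integrals of complex-valued functions *)

Notation ccontinuous := (@continuous R_UniformSpace C_R).
Notation CInt := (@RInt C_R).

Lemma ccontinuous_pair (f : R -> C) (t : R) :
  ccontinuous f t <-> continuous (fun s => fst (f s)) t /\ continuous (fun s => snd (f s)) t.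
Proof.
  split.
  - intros H. split.
    + apply (continuous_comp f (fun z : C => fst z)); [exact H | apply continuous_fst].
    + apply (continuous_comp f (fun z : C => snd z)); [exact H | apply continuous_snd].
  - intros [H1 H2].
    eapply continuous_ext. 2: eapply (continuous_comp_2 _ _ (fun a b => (a, b)) t H1 H2).
    + intros s. simpl. now destruct (f s).
    + apply continuous_ext with (f := fun x : R * R => x). now intros []. apply continuous_id.
Qed.

Lemma ex_CInt (f : R -> C) (a b : R) :
  a <= b -> (forall t, a <= t <= b -> ccontinuous f t) -> @ex_RInt C_R f a b.
Proof.
  intros Hab H. apply ex_RInt_continuous. rewrite Rmin_left, Rmax_right by lra. exact H.
Qed.

Lemma CInt_pair (f : R -> C) (a b : R) :
  @ex_RInt C_R f a b ->
  CInt f a b = (RInt (fun t => fst (f t)) a b, RInt (fun t => snd (f t)) a b).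
Proof.
  intros [l H]. rewrite (@is_RInt_unique C_R f a b l H).
  pose proof (is_RInt_fct_extend_fst f a b l H) as H1.
  pose proof (is_RInt_fct_extend_snd f a b l H) as H2.
  apply (@is_RInt_unique R_CompleteNormedModule) in H1, H2. symmetry. apply injective_projections; [exact H1 | exact H2].
Qed.

Lemma is_CInt_scal (c : C) (f : R -> C) (a b : R) (l : C) :
  @is_RInt C_R f a b l -> @is_RInt C_R (fun t => c * f t)%C a b (c * l)%C.
Proof.
  intros H.
  pose proof (is_RInt_fct_extend_fst f a b l H) as H1.
  pose proof (is_RInt_fct_extend_snd f a b l H) as H2.
  apply (@is_RInt_fct_extend_pair R_NormedModule R_NormedModule).
  - apply (is_RInt_minus (fun t => fst c * fst (f t)) (fun t => snd c * snd (f t))).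
    apply (is_RInt_scal (fun t => fst (f t)) a b (fst c) (fst l) H1).
    apply (is_RInt_scal (fun t => snd (f t)) a b (snd c) (snd l) H2).
  - apply (is_RInt_plus (fun t => fst c * snd (f t)) (fun t => snd c * fst (f t))).
    apply (is_RInt_scal (fun t => snd (f t)) a b (fst c) (snd l) H2).
    apply (is_RInt_scal (fun t => fst (f t)) a b (snd c) (fst l) H1).
Qed.

Lemma CInt_scal (c : C) (f : R -> C) (a b : R) :
  @ex_RInt C_R f a b -> CInt (fun t => c * f t)%C a b = (c * CInt f a b)%C.
Proof.
  intros H. apply (@is_RInt_unique C_R). apply is_CInt_scal. now apply (@RInt_correct C_R).
Qed.

Lemma CInt_plus (f g : R -> C) (a b : R) :
  @ex_RInt C_R f a b -> @ex_RInt C_R g a b ->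
  CInt (fun t => f t + g t)%C a b = (CInt f a b + CInt g a b)%C.
Proof. intros Hf Hg. exact (@RInt_plus C_R f g a b Hf Hg). Qed.

Lemma CInt_minus (f g : R -> C) (a b : R) :
  @ex_RInt C_R f a b -> @ex_RInt C_R g a b ->
  CInt (fun t => f t - g t)%C a b = (CInt f a b - CInt g a b)%C.
Proof. intros Hf Hg. exact (@RInt_minus C_R f g a b Hf Hg). Qed.

Lemma CInt_ext (f g : R -> C) (a b : R) :
  a <= b -> (forall t, a < t < b -> f t = g t) -> CInt f a b = CInt g a b.
Proof. intros Hab H. apply RInt_ext. rewrite Rmin_left, Rmax_right by lra. exact H. Qed.

Lemma CInt_const (c : C) (a b : R) : CInt (fun _ => c) a b = (RtoC (b - a) * c)%C.
Proof. rewrite RInt_const. cring. Qed.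

Lemma Cmod_CInt_le (f : R -> C) (a b m : R) :
  a <= b -> (forall t, a <= t <= b -> ccontinuous f t) ->
  (forall t, a <= t <= b -> Cmod (f t) <= m) -> Cmod (CInt f a b) <= m * (b - a).
Proof.
  intros Hab Hc Hm. rewrite <- norm_C_R, Rmult_comm.
  apply (norm_RInt_le f (fun _ => m) a b (CInt f a b) ((b - a) * m) Hab).
  - intros t Ht. rewrite norm_C_R. now apply Hm.
  - apply (@RInt_correct C_R). now apply ex_CInt.
  - apply @is_RInt_const.
Qed.

(** Quantitative differentiation under the integral sign: [g1] and [g2] are the integrand at two
    parameters, [c] their difference and [g3] the candidate derivative. *)
Lemma CInt_remainder (g1 g2 g3 : R -> C) (c : C) (a b m : R) :
  a <= b -> (forall t, a <= t <= b -> ccontinuous g1 t) ->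
  (forall t, a <= t <= b -> ccontinuous g2 t) -> (forall t, a <= t <= b -> ccontinuous g3 t) ->
  (forall t, a <= t <= b -> Cmod (g1 t - g2 t - c * g3 t)%C <= m) ->
  Cmod (CInt g1 a b - CInt g2 a b - c * CInt g3 a b)%C <= m * (b - a).
Proof.
  intros Hab H1 H2 H3 Hm.
  assert (C3 : forall t, a <= t <= b -> ccontinuous (fun t => c * g3 t)%C t).
  { intros t Ht. apply (continuous_Cmult _ (fun _ => c)). apply continuous_const. auto. }
  assert (C12 : forall t, a <= t <= b -> ccontinuous (fun t => g1 t - g2 t)%C t).
  { intros t Ht. apply (@continuous_minus R_UniformSpace R_AbsRing C_R g1 g2); auto. }
  rewrite <- CInt_scal, <- !CInt_minus by (apply ex_CInt; auto).
  apply Cmod_CInt_le; auto.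
  intros t Ht. apply (@continuous_minus R_UniformSpace R_AbsRing C_R (fun t => g1 t - g2 t)%C (fun t => c * g3 t)%C); auto.
Qed.

(** * Closed complex-valued forms on the real plane *)

Notation R2 := (prod_NormedModule R_AbsRing R_NormedModule R_NormedModule).

(** Total differentiability with partial derivatives [px] and [py], phrased by [filterdiff] so that
    chain and product rules handle complex values at once; components appear only when real
    statements are invoked. *)
Definition cdiff2 (P : R * R -> C) (x y : R) (px py : C) : Prop :=
  @filterdiff R_AbsRing R2 C_R P (locally (x, y))
    (fun h => RtoC (fst h) * px + RtoC (snd h) * py)%C.

Lemma cdiff2_fst (P : R * R -> C) (x y : R) (px py : C) :
  cdiff2 P x y px py ->
  differentiable_pt_lim (fun u v => fst (P (u, v))) x y (fst px) (fst py).
Proof.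
  intros H. apply filterdiff_differentiable_pt_lim.
  pose proof (@filterdiff_comp' R_AbsRing R2 C_R R_NormedModule P (fun z => fst z) (x, y) _ _ H
    (filterdiff_linear _ (@is_linear_fst R_AbsRing R_NormedModule R_NormedModule))) as K.
  eapply filterdiff_ext_lin. eapply filterdiff_ext. 2: exact K.
  - intros [u v]. reflexivity.
  - intros [u v]. simpl. ring.
Qed.

Lemma cdiff2_snd (P : R * R -> C) (x y : R) (px py : C) :
  cdiff2 P x y px py ->
  differentiable_pt_lim (fun u v => snd (P (u, v))) x y (snd px) (snd py).
Proof.
  intros H. apply filterdiff_differentiable_pt_lim.
  pose proof (@filterdiff_comp' R_AbsRing R2 C_R R_NormedModule P (fun z => snd z) (x, y) _ _ H
    (filterdiff_linear _ (@is_linear_snd R_AbsRing R_NormedModule R_NormedModule))) as K.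
  eapply filterdiff_ext_lin. eapply filterdiff_ext. 2: exact K.
  - intros [u v]. reflexivity.
  - intros [u v]. simpl. ring.
Qed.

Lemma cdiff2_comp (f : C -> C) (P : R * R -> C) (x y : R) (px py d : C) :
  is_cderive f (P (x, y)) d -> cdiff2 P x y px py ->
  cdiff2 (fun u => f (P u)) x y (px * d) (py * d).
Proof.
  intros Hf HP. apply is_cderive_filterdiff in Hf.
  pose proof (@filterdiff_comp' R_AbsRing R2 C_R C_R P f (x, y) _ _ HP Hf) as K.
  eapply filterdiff_ext_lin. exact K. intros [u v]. simpl. cring.
Qed.

Lemma cdiff2_mult (P Q : R * R -> C) (x y : R) (px py qx qy : C) :
  cdiff2 P x y px py -> cdiff2 Q x y qx qy ->
  cdiff2 (fun u => P u * Q u)%C x y (px * Q (x, y) + P (x, y) * qx) (py * Q (x, y) + P (x, y) * qy).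
Proof.
  intros HP HQ.
  pose proof (@filterdiff_comp'_2 R_AbsRing R2 C_R C_R C_R P Q Cmult (x, y) _ _
     (fun u v => u * Q (x, y) + v * P (x, y))%C HP HQ (filterdiff_Cmult (P (x, y)) (Q (x, y)))) as H.
  eapply filterdiff_ext_lin. exact H. intros [u v]. simpl. cring.
Qed.

Lemma cdiff2_plus (P Q : R * R -> C) (x y : R) (px py qx qy : C) :
  cdiff2 P x y px py -> cdiff2 Q x y qx qy ->
  cdiff2 (fun u => P u + Q u)%C x y (px + qx) (py + qy).
Proof.
  intros HP HQ.
  eapply filterdiff_ext_lin. apply (@filterdiff_plus_fct R_AbsRing R2 C_R _ _ P Q _ _ HP HQ).
  intros [u v]. simpl. cring.
Qed.

Lemma cdiff2_left (g : R -> C) (x y : R) (d : C) :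
  is_rderive g x d -> cdiff2 (fun u => g (fst u)) x y d 0.
Proof.
  intros H.
  pose proof (@filterdiff_comp' R_AbsRing R2 R_NormedModule C_R (fun u => fst u) g (x, y) _ _
    (filterdiff_linear _ (@is_linear_fst R_AbsRing R_NormedModule R_NormedModule)) H) as K.
  eapply filterdiff_ext_lin. exact K. intros [u v]. cring.
Qed.

Lemma cdiff2_right (g : R -> C) (x y : R) (d : C) :
  is_rderive g y d -> cdiff2 (fun u => g (snd u)) x y 0 d.
Proof.
  intros H.
  pose proof (@filterdiff_comp' R_AbsRing R2 R_NormedModule C_R (fun u => snd u) g (x, y) _ _
    (filterdiff_linear _ (@is_linear_snd R_AbsRing R_NormedModule R_NormedModule)) H) as K.
  eapply filterdiff_ext_lin. exact K. intros [u v]. cring.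
Qed.

Lemma cdiff2_eq (P : R * R -> C) (x y : R) (px py qx qy : C) :
  cdiff2 P x y px py -> px = qx -> py = qy -> cdiff2 P x y qx qy.
Proof. now intros H <- <-. Qed.

Lemma cdiff2_continuous_left (P : R * R -> C) (x y : R) (px py : C) :
  cdiff2 P x y px py -> ccontinuous (fun u => P (u, y)) x.
Proof.
  intros H. apply ccontinuous_pair. split.
  - apply (differentiable_pt_lim_continuous_l (fun u v => fst (P (u, v))) x y (fst px) (fst py)).
    now apply cdiff2_fst.
  - apply (differentiable_pt_lim_continuous_l (fun u v => snd (P (u, v))) x y (snd px) (snd py)).
    now apply cdiff2_snd.
Qed.

(** The shared [k] says that [P dx + Q dy] is closed. In Green's identity the two vertical sides
    cancel by periodicity of [Q]: this is homotopy invariance of loop integrals in coordinates. *)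
Lemma closed_form_loop_invariance (P Q : R * R -> C) (a b c d : R) :
  a < b -> c < d ->
  (forall x y, a <= x <= b -> c <= y <= d -> exists px k qy, cdiff2 P x y px k /\ cdiff2 Q x y k qy) ->
  (forall y, c <= y <= d -> Q (a, y) = Q (b, y)) ->
  CInt (fun x => P (x, d)) a b = CInt (fun x => P (x, c)) a b.
Proof.
  intros Hab Hcd H HQ.
  assert (E : forall y, c <= y <= d -> @ex_RInt C_R (fun x => P (x, y)) a b).
  { intros y Hy. apply ex_CInt. lra. intros x Hx. destruct (H x y Hx Hy) as (px & k & qy & HP & _).
    eapply cdiff2_continuous_left, HP. }
  rewrite !CInt_pair by (apply E; lra).
  f_equal; apply Rminus_diag_uniq.
  - pose proof (green_rectangle (fun u v => fst (P (u, v))) (fun u v => fst (Q (u, v))) a b c d Hab Hcd) as G.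
    simpl in G. rewrite G.
    + rewrite (RInt_ext (fun y => fst (Q (b, y))) (fun y => fst (Q (a, y)))). ring.
      rewrite Rmin_left, Rmax_right by lra. intros y Hy. f_equal. symmetry. apply HQ. lra.
    + intros x y Hx Hy. destruct (H x y Hx Hy) as (px & k & qy & H1 & H2).
      exists (fst px), (fst k), (fst qy). split; now apply cdiff2_fst.
  - pose proof (green_rectangle (fun u v => snd (P (u, v))) (fun u v => snd (Q (u, v))) a b c d Hab Hcd) as G.
    simpl in G. rewrite G.
    + rewrite (RInt_ext (fun y => snd (Q (b, y))) (fun y => snd (Q (a, y)))). ring.
      rewrite Rmin_left, Rmax_right by lra. intros y Hy. f_equal. symmetry. apply HQ. lra.
    + intros x y Hx Hy. destruct (H x y Hx Hy) as (px & k & qy & H1 & H2).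
      exists (snd px), (snd k), (snd qy). split; now apply cdiff2_snd.
Qed.

(** * Cauchy's integral formula *)

Definition cis (t : R) : C := (cos t, sin t).

Lemma Cmod_cis (t : R) : Cmod (cis t) = 1.
Proof.
  unfold Cmod, cis; simpl. rewrite !Rmult_1_r. rewrite Rplus_comm.
  pose proof (sin2_cos2 t) as H. unfold Rsqr in H. rewrite H. apply sqrt_1.
Qed.

Lemma is_rderive_cis (t : R) : is_rderive cis t (Ci * cis t)%C.
Proof.
  replace (Ci * cis t)%C with ((- sin t, cos t) : C) by (unfold cis; cring).
  apply is_rderive_pair; auto_derive; trivial; ring.
Qed.

Lemma is_rderive_eq (f : R -> C) (t : R) (d d' : C) :
  is_rderive f t d -> d = d' -> is_rderive f t d'.
Proof. now intros H <-. Qed.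

Lemma is_rderive_const (c : C) (t : R) : is_rderive (fun _ => c) t (RtoC 0).
Proof. exact (@is_derive_const R_AbsRing C_R c t). Qed.

Lemma is_rderive_minus (f g : R -> C) (t : R) (df dg : C) :
  is_rderive f t df -> is_rderive g t dg -> is_rderive (fun s => f s - g s)%C t (df - dg)%C.
Proof. exact (@is_derive_minus R_AbsRing C_R f g t df dg). Qed.

Lemma is_rderive_scal (c : C) (f : R -> C) (t : R) (d : C) :
  is_rderive f t d -> is_rderive (fun s => c * f s)%C t (c * d)%C.
Proof.
  intros H. eapply is_rderive_eq. apply (is_rderive_mult _ _ _ _ _ (is_rderive_const c t) H). ring.
Qed.

Lemma is_rderive_RtoC (t : R) : is_rderive RtoC t (RtoC 1).
Proof. apply (is_rderive_pair (fun s => s) (fun _ => 0)); auto_derive; auto. Qed.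

Lemma Cmod_RtoC_nonneg (t : R) : 0 <= t -> Cmod (RtoC t) = t.
Proof. intros H. rewrite Cmod_R. now apply Rabs_pos_eq. Qed.

Lemma Cmod_circle (r : R) (t : R) : 0 <= r -> Cmod (RtoC r * cis t)%C = r.
Proof. intros H. rewrite Cmod_mult, Cmod_cis, Cmod_RtoC_nonneg by auto. ring. Qed.

Lemma circle_minus_lower (r : R) (a : C) (t : R) :
  0 <= r -> r - Cmod a <= Cmod (RtoC r * cis t - a)%C.
Proof.
  intros H. pose proof (Cmod_minus_ge (RtoC r * cis t)%C a) as K. now rewrite Cmod_circle in K.
Qed.

Lemma circle_minus_nz (r : R) (a : C) (t : R) :
  0 <= r -> Cmod a < r -> (RtoC r * cis t - a)%C <> RtoC 0.
Proof. intros H Ha. apply Cmod_gt_0. pose proof (circle_minus_lower r a t H). lra. Qed.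

(** The pole moves from [a] to 0 along [s * a]; the closed form is the differential of
    [log (r cis x - s a)]. At [s = 0] the integrand is the constant [Ci]. *)
Lemma circle_kernel_winding (r : R) (a : C) :
  Cmod a < r ->
  CInt (fun t => RtoC r * (Ci * cis t) * / (RtoC r * cis t - a))%C 0 (2 * PI) = (RtoC (2 * PI) * Ci)%C.
Proof.
  intros Ha. pose proof (Cmod_ge_0 a). pose proof PI_RGT_0.
  assert (NZ : forall x s, 0 <= s <= 1 -> (RtoC r * cis x - RtoC s * a)%C <> RtoC 0).
  { intros x s Hs. apply circle_minus_nz. lra.
    rewrite Cmod_mult, Cmod_RtoC_nonneg by lra. nra. }
  pose proof (closed_form_loop_invariance
    (fun u => RtoC r * (Ci * cis (fst u)) * / (RtoC r * cis (fst u) - RtoC (snd u) * a))%C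
    (fun u => - a * / (RtoC r * cis (fst u) - RtoC (snd u) * a))%C 0 (2 * PI) 0 1 ltac:(lra) ltac:(lra)) as G.
  cbn [fst snd] in G.
  rewrite (CInt_ext _ (fun t => RtoC r * (Ci * cis t) * / (RtoC r * cis t - RtoC 1 * a))%C).
  2: lra. 2: { intros t _. now rewrite Cmult_1_l. }
  rewrite G.
  - rewrite (CInt_ext _ (fun t => Ci)).
    { rewrite CInt_const. now rewrite Rminus_0_r. } { lra. }
    intros t _. field. specialize (NZ t 0 ltac:(lra)).
    split; intros N; apply NZ; rewrite N; ring.
  - intros x s Hx Hs. specialize (NZ x s Hs).
    assert (D : cdiff2 (fun u => / (RtoC r * cis (fst u) - RtoC (snd u) * a))%C x s
       (RtoC r * (Ci * cis x) * (- / ((RtoC r * cis x - RtoC s * a) * (RtoC r * cis x - RtoC s * a))))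
       (- a * (- / ((RtoC r * cis x - RtoC s * a) * (RtoC r * cis x - RtoC s * a))))).
    { apply (cdiff2_comp Cinv (fun u => RtoC r * cis (fst u) - RtoC (snd u) * a)%C).
      now apply is_cderive_inv.
      eapply cdiff2_eq.
      eapply (filterdiff_ext (fun u => (fun t => RtoC r * cis t) (fst u) + (fun t => (- a) * RtoC t) (snd u)))%C.
      { intros u. cring. }
      apply cdiff2_plus.
      apply (cdiff2_left (fun t => RtoC r * cis t)%C). apply is_rderive_scal, is_rderive_cis.
      apply (cdiff2_right (fun t => (- a) * RtoC t)%C). apply is_rderive_scal, is_rderive_RtoC.
      simpl; ring. simpl; ring. }
    eexists. eexists. eexists. split.
    + eapply cdiff2_eq.
      apply (cdiff2_mult (fun u => RtoC r * (Ci * cis (fst u)))%C).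
      apply (cdiff2_left (fun t => RtoC r * (Ci * cis t))%C).
      apply is_rderive_scal, is_rderive_scal, is_rderive_cis. exact D. reflexivity. reflexivity.
    + eapply cdiff2_eq.
      apply (cdiff2_mult (fun _ => (- a)%C)). apply (cdiff2_left (fun t => (- a)%C)).
      apply is_rderive_const. exact D.
      simpl. ring. reflexivity.
  - intros y Hy. unfold cis. now rewrite sin_2PI, cos_2PI, sin_0, cos_0.
Qed.

Lemma Cmod_cone_le (r t x : R) (a : C) :
  0 <= t <= 1 -> Cmod a <= r -> Cmod (a + RtoC t * (RtoC r * cis x - a))%C <= r.
Proof.
  intros Ht Ha. pose proof (Cmod_ge_0 a).
  replace (a + RtoC t * (RtoC r * cis x - a))%C with (RtoC (1 - t) * a + RtoC t * (RtoC r * cis x))%C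
    by (rewrite RtoC_minus; ring).
  eapply Rle_trans. apply Cmod_triangle.
  rewrite !Cmod_mult, Cmod_cis, !Cmod_RtoC_nonneg by lra. nra.
Qed.

Lemma circle_continuous (r x : R) : ccontinuous (fun t => RtoC r * cis t)%C x.
Proof. eapply is_rderive_continuous. apply is_rderive_scal, is_rderive_cis. Qed.

Lemma circle_kernel_continuous (r : R) (a : C) (x : R) :
  Cmod a < r -> ccontinuous (fun t => / (RtoC r * cis t - a))%C x.
Proof.
  intros Ha. eapply is_rderive_continuous.
  apply (is_rderive_comp Cinv). apply is_cderive_inv, circle_minus_nz; auto.
  pose proof (Cmod_ge_0 a); lra.
  apply is_rderive_minus. apply is_rderive_scal, is_rderive_cis. apply is_rderive_const.
Qed.

(* The circle is contracted to [a] along the cone with apex [a]; the closed form is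
   [f dw / (w - a)], whose angular component stays bounded at the apex. *)
Lemma cauchy_cone_invariance (f f' : C -> C) (r e : R) (a : C) :
  (forall z, Cmod z <= r -> is_cderive f z (f' z)) -> Cmod a < r -> 0 < e < 1 ->
  CInt (fun x => f (RtoC r * cis x) * (RtoC r * (Ci * cis x) * / (RtoC r * cis x - a)))%C 0 (2 * PI) =
  CInt (fun x => f (a + RtoC e * (RtoC r * cis x - a)) *
                 (RtoC r * (Ci * cis x) * / (RtoC r * cis x - a)))%C 0 (2 * PI).
Proof.
  intros Hf Ha He. pose proof (Cmod_ge_0 a). pose proof PI_RGT_0.
  assert (NZ : forall x, (RtoC r * cis x - a)%C <> RtoC 0) by (intros x; apply circle_minus_nz; lra).
  (* With [c = r cis x] and [w = a + s (c - a)], [dw / (w - a)] splits into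
     [c' / (c - a) dx + ds / s]; the second part is singular at [s = 0], so the contraction stops at
     [s = e]. *)
  pose proof (closed_form_loop_invariance
    (fun u => f (a + RtoC (snd u) * (RtoC r * cis (fst u) - a)) *
        (RtoC r * (Ci * cis (fst u)) * / (RtoC r * cis (fst u) - a)))%C
    (fun u => f (a + RtoC (snd u) * (RtoC r * cis (fst u) - a)) * / RtoC (snd u))%C
    0 (2 * PI) e 1 ltac:(lra) ltac:(lra)) as G.
  cbn [fst snd] in G. rewrite <- G.
  - apply CInt_ext. lra. intros x _. f_equal. f_equal. ring.
  - intros x s Hx Hs. specialize (NZ x).
    assert (S0 : RtoC s <> RtoC 0) by (intros N; apply RtoC_inj in N; lra).
    assert (DK : is_rderive (fun x => RtoC r * cis x - a)%C x (RtoC r * (Ci * cis x))%C).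
    { eapply is_rderive_eq. apply is_rderive_minus. apply is_rderive_scal, is_rderive_cis.
      apply is_rderive_const. ring. }
    assert (Dg : cdiff2 (fun u => a + RtoC (snd u) * (RtoC r * cis (fst u) - a))%C x s
      (RtoC s * (RtoC r * (Ci * cis x)))%C (RtoC r * cis x - a)%C).
    { eapply cdiff2_eq.
      apply (cdiff2_plus (fun _ => a)). apply (cdiff2_left (fun _ => a)). apply is_rderive_const.
      apply (cdiff2_mult (fun u => RtoC (snd u))). apply (cdiff2_right RtoC). apply is_rderive_RtoC.
      apply (cdiff2_left (fun x => RtoC r * cis x - a)%C). exact DK.
      simpl. ring. simpl; ring. }
    assert (Df := cdiff2_comp f _ x s _ _ _ (Hf _ (Cmod_cone_le r s x a ltac:(lra) ltac:(lra))) Dg).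
    eexists. eexists. eexists. split.
    + eapply cdiff2_eq. eapply (cdiff2_mult _ _ x s _ _ _ _ Df).
      apply (cdiff2_left (fun x => RtoC r * (Ci * cis x) * / (RtoC r * cis x - a))%C).
      apply is_rderive_mult. apply is_rderive_scal, is_rderive_scal, is_rderive_cis.
      apply (is_rderive_comp Cinv _ _ _ _ (is_cderive_inv _ NZ) DK).
      reflexivity. reflexivity.
    + eapply cdiff2_eq. eapply (cdiff2_mult _ _ x s _ _ _ _ Df).
      apply (cdiff2_right (fun s => / RtoC s)%C).
      apply (is_rderive_comp Cinv _ _ _ _ (is_cderive_inv _ S0) (is_rderive_RtoC s)).
      simpl. field. split; auto. reflexivity.
  - intros y Hy. unfold cis. now rewrite sin_2PI, cos_2PI, sin_0, cos_0.
Qed.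

(** As [e] tends to 0 on the cone, the values of [f] tend uniformly to [f a] by continuity at [a],
    and what remains is the winding integral. *)
Lemma cauchy_formula (f f' : C -> C) (r : R) (a : C) :
  (forall z, Cmod z <= r -> is_cderive f z (f' z)) -> Cmod a < r ->
  CInt (fun x => f (RtoC r * cis x) * (RtoC r * (Ci * cis x) * / (RtoC r * cis x - a)))%C 0 (2 * PI) =
  (f a * (RtoC (2 * PI) * Ci))%C.
Proof.
  intros Hf Ha. pose proof (Cmod_ge_0 a) as A0. pose proof PI_RGT_0 as HPI.
  set (K := fun x => (RtoC r * (Ci * cis x) * / (RtoC r * cis x - a))%C).
  set (J := CInt _ _ _).
  assert (CK : forall x, ccontinuous K x).
  { intros x. apply continuous_Cmult.
    eapply is_rderive_continuous. apply is_rderive_scal, is_rderive_scal, is_rderive_cis.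
    now apply circle_kernel_continuous. }
  assert (BK : forall x, Cmod (K x) <= r / (r - Cmod a)).
  { intros x. unfold K. rewrite Cmod_mult, Cmod_inv by (apply circle_minus_nz; lra).
    rewrite !Cmod_mult, Cmod_Ci, Cmod_cis, Cmod_RtoC_nonneg by lra.
    unfold Rdiv. rewrite !Rmult_1_r. apply Rmult_le_compat_l. lra. apply Rinv_le_contravar. lra.
    apply circle_minus_lower. lra. }
  assert (B0 : 0 < r / (r - Cmod a)) by (apply Rdiv_lt_0_compat; lra).
  apply Ceq_minus, Cmod_eq_0. apply Rle_antisym; [ | apply Cmod_ge_0].
  apply le_epsilon. intros eps Heps. rewrite Rplus_0_l.
  (* [eps] divided by the kernel bound and the length [2 PI]. The later [e] keeps the contracted
     circle within [de] of [a], since [|r cis x - a| <= 2 r]. *)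
  set (eta := eps / (r / (r - Cmod a) * (2 * PI))).
  assert (Heta : 0 < eta) by (apply Rdiv_lt_0_compat; nra).
  pose proof (is_cderive_continuous f a _ (Hf a ltac:(lra))) as Cf.
  specialize (Cf (fun w => Cmod (w - f a)%C < eta)).
  destruct (proj1 (locally_C_Cmod a _) (Cf ltac:(apply locally_C_Cmod; now exists (mkposreal _ Heta)))) as [de Hde].
  pose proof (cond_pos de) as Dpos.
  set (e := Rmin (1 / 2) (de / (4 * r))).
  assert (He : 0 < e < 1).
  { unfold e. split. apply Rmin_pos. lra. apply Rdiv_lt_0_compat; lra.
    eapply Rle_lt_trans. apply Rmin_l. lra. }
  assert (He2 : e * (2 * r) < de).
  { assert (e <= de / (4 * r)) by apply Rmin_r.
    apply (Rmult_le_compat_r (2 * r)) in H. 2: lra.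
    replace (de / (4 * r) * (2 * r)) with (de / 2) in H by (field; lra). lra. }
  unfold J. rewrite (cauchy_cone_invariance f f' r e a Hf Ha He).
  rewrite <- (circle_kernel_winding r a Ha). fold K.
  set (g := fun x => (a + RtoC e * (RtoC r * cis x - a))%C).
  assert (Cg : forall x, ccontinuous (fun x => f (g x)) x).
  { intros x. apply (@continuous_comp R_UniformSpace C_R C_R g f).
    - eapply is_rderive_continuous. unfold g.
      apply (@is_derive_plus R_AbsRing C_R). apply is_rderive_const.
      apply is_rderive_scal. apply is_rderive_minus. apply is_rderive_scal, is_rderive_cis. apply is_rderive_const.
    - eapply is_cderive_continuous, Hf. apply Cmod_cone_le; lra. }
  rewrite <- CInt_scal by (apply ex_CInt; [lra | auto]).
  rewrite <- CInt_minus.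
  2: { apply ex_CInt. lra. intros t _. apply (continuous_Cmult _ (fun x => f (g x)) K); auto. }
  2: { apply ex_CInt. lra. intros t _. apply (continuous_Cmult _ (fun x => f a) K); auto. apply continuous_const. }
  replace eps with (eta * (r / (r - Cmod a)) * (2 * PI - 0)).
  2: { unfold eta. field. split; [ | split]; lra. }
  apply Cmod_CInt_le. lra.
  - intros t _. apply (@continuous_minus R_UniformSpace R_AbsRing C_R (fun x => f (g x) * K x)%C (fun x => f a * K x)%C).
    apply (continuous_Cmult _ (fun x => f (g x)) K); auto.
    apply (continuous_Cmult _ (fun x => f a) K); auto. apply continuous_const.
  - intros t _. fold (K t). fold (g t).
    replace (f (g t) * K t - f a * K t)%C with ((f (g t) - f a) * K t)%C by ring.
    rewrite Cmod_mult. apply Rmult_le_compat; try apply Cmod_ge_0; auto.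
    apply Rlt_le, Hde. unfold g.
    replace (a + RtoC e * (RtoC r * cis t - a) - a)%C with (RtoC e * (RtoC r * cis t - a))%C by ring.
    rewrite Cmod_mult, Cmod_RtoC_nonneg by lra.
    eapply Rle_lt_trans. 2: exact He2. apply Rmult_le_compat_l. lra.
    eapply Rle_trans. apply Cmod_triangle. rewrite Cmod_opp, Cmod_circle; lra.
Qed.

(** * Taylor remainders on discs *)

(** Carries the [1 / (2 pi i)] of Cauchy's formula; the integrand is expected to contain
    [dw = i r cis t dt]. *)
Definition circle_mean (g : R -> C) : C := (/ (RtoC (2 * PI) * Ci) * CInt g 0 (2 * PI))%C.

Lemma two_pi_Ci_nz : (RtoC (2 * PI) * Ci)%C <> RtoC 0.
Proof.
  apply Cmult_neq_0. 2: exact Ci_nz. intros N. apply RtoC_inj in N. pose proof PI_RGT_0. lra.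
Qed.

Lemma circle_mean_bound (g : R -> C) (m : R) :
  (forall t, ccontinuous g t) -> (forall t, 0 <= t <= 2 * PI -> Cmod (g t) <= m) ->
  Cmod (circle_mean g) <= m.
Proof.
  intros Hc Hm. pose proof PI_RGT_0. unfold circle_mean.
  rewrite Cmod_mult, Cmod_inv by exact two_pi_Ci_nz.
  rewrite Cmod_mult, Cmod_Ci, Cmod_RtoC_nonneg by lra.
  pose proof (Cmod_CInt_le g 0 (2 * PI) m ltac:(lra) (fun t _ => Hc t) Hm) as B.
  apply (Rmult_le_reg_l (2 * PI)). lra.
  replace (2 * PI * (/ (2 * PI * 1) * Cmod (CInt g 0 (2 * PI)))) with (Cmod (CInt g 0 (2 * PI))) by (field; lra).
  lra.
Qed.

Lemma circle_mean_remainder (g1 g2 g3 : R -> C) (c : C) (m : R) :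
  (forall t, ccontinuous g1 t) -> (forall t, ccontinuous g2 t) -> (forall t, ccontinuous g3 t) ->
  (forall t, 0 <= t <= 2 * PI -> Cmod (g1 t - g2 t - c * g3 t)%C <= m) ->
  Cmod (circle_mean g1 - circle_mean g2 - c * circle_mean g3)%C <= m.
Proof.
  intros H1 H2 H3 Hm. pose proof PI_RGT_0.
  pose proof (CInt_remainder g1 g2 g3 c 0 (2 * PI) m ltac:(lra) ltac:(auto) ltac:(auto) ltac:(auto) Hm) as B.
  replace (circle_mean g1 - circle_mean g2 - c * circle_mean g3)%C with
    (/ (RtoC (2 * PI) * Ci) * (CInt g1 0 (2 * PI) - CInt g2 0 (2 * PI) - c * CInt g3 0 (2 * PI)))%C
    by (unfold circle_mean; ring).
  rewrite Cmod_mult, Cmod_inv, Cmod_mult, Cmod_Ci, Cmod_RtoC_nonneg by (lra || exact two_pi_Ci_nz).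
  apply (Rmult_le_reg_l (2 * PI)). lra.
  match goal with |- _ * (_ * ?u) <= _ => replace (2 * PI * (/ (2 * PI * 1) * u)) with u by (field; lra) end.
  lra.
Qed.

(** [f1] and [f2] are Cauchy integrals with kernels [K^2] and [2 K^3], hence first and second
    derivatives. The remainders are algebra on the kernel: [K w - K z - (w - z) (K z)^2 = K w (K
    z)^2 (w - z)^2], and an analogue for [K^2] whose extra factor [3 - 2 (w - z) K z] explains the
    last constant. *)
Lemma cauchy_taylor (f f' : C -> C) (r rho B : R) :
  (forall z, Cmod z <= r -> is_cderive f z (f' z)) -> 0 <= rho < r ->
  (forall t, 0 <= t <= 2 * PI -> Cmod (f (RtoC r * cis t)%C) <= B) ->
  exists f1 f2 : C -> C,
    (forall z, Cmod z <= rho -> Cmod (f1 z) <= B * r / (r - rho) ^ 2) /\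
    (forall z w, Cmod z <= rho -> Cmod w <= rho ->
       Cmod (f w - f z - f1 z * (w - z))%C <= B * r / (r - rho) ^ 3 * Cmod (w - z)%C ^ 2) /\
    (forall z w, Cmod z <= rho -> Cmod w <= rho ->
       Cmod (f1 w - f1 z - f2 z * (w - z))%C <=
       B * r / (r - rho) ^ 4 * (3 + 4 * rho / (r - rho)) * Cmod (w - z)%C ^ 2).
Proof.
  intros Hf Hr HB.
  set (phi := fun t => (f (RtoC r * cis t) * (RtoC r * (Ci * cis t)))%C).
  set (K := fun z t => (/ (RtoC r * cis t - z))%C).
  assert (B0 : 0 <= B).
  { eapply Rle_trans. apply Cmod_ge_0. apply (HB 0). pose proof PI_RGT_0. lra. }
  assert (Bphi : forall t, 0 <= t <= 2 * PI -> Cmod (phi t) <= B * r).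
  { intros t Ht. unfold phi. rewrite !Cmod_mult, Cmod_Ci, Cmod_cis, Cmod_RtoC_nonneg by lra.
    rewrite !Rmult_1_r. apply Rmult_le_compat_r; auto. lra. }
  assert (BK : forall z t, Cmod z <= rho -> Cmod (K z t) <= / (r - rho)).
  { intros z t Hz. unfold K. rewrite Cmod_inv by (apply circle_minus_nz; lra).
    apply Rinv_le_contravar. lra. pose proof (circle_minus_lower r z t). lra. }
  assert (Cphi : forall t, ccontinuous phi t).
  { intros t. apply continuous_Cmult.
    - apply (@continuous_comp R_UniformSpace C_R C_R (fun t => RtoC r * cis t)%C f). apply circle_continuous.
      eapply is_cderive_continuous, Hf. rewrite Cmod_circle; lra.
    - eapply is_rderive_continuous. apply is_rderive_scal, is_rderive_scal, is_rderive_cis. }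
  assert (CK : forall z t, Cmod z <= rho -> ccontinuous (K z) t).
  { intros z t Hz. apply circle_kernel_continuous. lra. }
  assert (C1 : forall z t, Cmod z <= rho -> ccontinuous (fun t => phi t * K z t)%C t).
  { intros z t Hz. apply continuous_Cmult; auto. }
  assert (C2 : forall z t, Cmod z <= rho -> ccontinuous (fun t => phi t * (K z t * K z t))%C t).
  { intros z t Hz. apply continuous_Cmult; auto. apply continuous_Cmult; auto. }
  assert (C3 : forall z t, Cmod z <= rho -> ccontinuous (fun t => phi t * (2 * K z t * (K z t * K z t)))%C t).
  { intros z t Hz. apply continuous_Cmult; auto. apply continuous_Cmult; auto.
    apply continuous_Cmult; auto. apply continuous_const. apply continuous_Cmult; auto. }
  assert (F : forall z, Cmod z <= rho -> f z = circle_mean (fun t => phi t * K z t)%C).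
  { intros z Hz. unfold circle_mean, phi, K.
    rewrite (CInt_ext _ (fun t => f (RtoC r * cis t) * (RtoC r * (Ci * cis t) * / (RtoC r * cis t - z)))%C).
    - rewrite (cauchy_formula f f' r z Hf) by lra. field.
      split. exact Ci_nz. intros N. apply RtoC_inj in N. pose proof PI_RGT_0. lra.
    - pose proof PI_RGT_0. lra.
    - intros t _. ring. }
  assert (Hd : 0 < / (r - rho)) by (apply Rinv_0_lt_compat; lra).
  exists (fun z => circle_mean (fun t => phi t * (K z t * K z t))%C),
         (fun z => circle_mean (fun t => phi t * (2 * K z t * (K z t * K z t)))%C).
  assert (NZ : forall z t, Cmod z <= rho -> (RtoC r * cis t - z)%C <> RtoC 0)
    by (intros; apply circle_minus_nz; lra).
  split; [ | split].
  - intros z Hz. apply circle_mean_bound; auto. intros t Ht.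
    replace (B * r / (r - rho) ^ 2) with (B * r * (/ (r - rho) * / (r - rho))) by (field; lra).
    rewrite !Cmod_mult. repeat apply Rmult_le_compat; repeat apply Rmult_le_pos; try apply Cmod_ge_0; auto.
  - intros z w Hz Hw. rewrite (F z Hz), (F w Hw), (Cmult_comm _ (w - z)%C).
    apply circle_mean_remainder; auto. intros t Ht.
    replace (phi t * K w t - phi t * K z t - (w - z) * (phi t * (K z t * K z t)))%C with
      (phi t * (K w t * (K z t * K z t)) * ((w - z) * (w - z)))%C.
    2: { unfold K. field. split; apply NZ; auto. }
    replace (B * r / (r - rho) ^ 3 * Cmod (w - z)%C ^ 2) with
      (B * r * (/ (r - rho) * (/ (r - rho) * / (r - rho))) * (Cmod (w - z)%C * Cmod (w - z)%C)) by (field; lra).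
    rewrite !Cmod_mult. repeat apply Rmult_le_compat; repeat apply Rmult_le_pos; try apply Cmod_ge_0; auto; lra.
  - intros z w Hz Hw. rewrite (Cmult_comm _ (w - z)%C).
    apply circle_mean_remainder; auto. intros t Ht.
    replace (phi t * (K w t * K w t) - phi t * (K z t * K z t) - (w - z) * (phi t * (2 * K z t * (K z t * K z t))))%C
      with (phi t * ((K w t * K w t) * (K z t * K z t)) * (3 - 2 * (w - z) * K z t) * ((w - z) * (w - z)))%C.
    2: { unfold K. field. split; apply NZ; auto. }
    replace (B * r / (r - rho) ^ 4 * (3 + 4 * rho / (r - rho)) * Cmod (w - z)%C ^ 2) with
      (B * r * ((/ (r - rho) * / (r - rho)) * (/ (r - rho) * / (r - rho))) * (3 + 2 * (rho + rho) * / (r - rho))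
       * (Cmod (w - z)%C * Cmod (w - z)%C)) by (field; lra).
    assert (T : Cmod (3 - 2 * (w - z) * K z t)%C <= 3 + 2 * (rho + rho) * / (r - rho)).
    { eapply Rle_trans. apply Cmod_triangle. rewrite Cmod_opp, !Cmod_mult.
      rewrite !Cmod_RtoC_nonneg by lra.
      apply Rplus_le_compat_l. apply Rmult_le_compat; try apply Cmod_ge_0; auto.
      apply Rmult_le_pos. lra. apply Cmod_ge_0.
      apply Rmult_le_compat_l. lra. eapply Rle_trans. apply Cmod_triangle. rewrite Cmod_opp. lra. }
    set (X := (3 - _)%C) in *. rewrite !Cmod_mult.
    repeat apply Rmult_le_compat; repeat apply Rmult_le_pos; try apply Cmod_ge_0; auto; lra.
Qed.

Definition derivative_on_disk (f f' : C -> C) : Prop :=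
  forall z, in_disk z -> is_cderive f z (f' z).

Lemma analytic_derivative (f : C -> C) :
  analytic_on_disk f -> derivative_on_disk f (C_derive f).
Proof. intros H z Hz. apply C_derive_correct; auto. exact (H z Hz). Qed.

Lemma derivative_analytic (f f' : C -> C) : derivative_on_disk f f' -> analytic_on_disk f.
Proof. intros H z Hz. exists (f' z). auto. Qed.

Lemma bounded_on_circle (f f' : C -> C) (r : R) :
  derivative_on_disk f f' -> 0 <= r < 1 ->
  exists B, forall t, 0 <= t <= 2 * PI -> Cmod (f (RtoC r * cis t)%C) <= B.
Proof.
  intros Hf Hr. pose proof PI_RGT_0.
  destruct (continuity_ab_maj (fun t => Cmod (f (RtoC r * cis t)%C)) 0 (2 * PI)) as [M HM].
  - lra.
  - intros t Ht. apply continuity_pt_filterlim.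
    apply (continuous_ext (fun t => @norm R_AbsRing C_R (f (RtoC r * cis t)%C))).
    { intros s. apply norm_C_R. }
    apply (@continuous_comp R_UniformSpace C_R R_UniformSpace (fun t => f (RtoC r * cis t)%C)).
    + apply (@continuous_comp R_UniformSpace C_R C_R (fun t => RtoC r * cis t)%C f). apply circle_continuous.
      eapply is_cderive_continuous, Hf. unfold in_disk. rewrite Cmod_circle; lra.
    + apply (@filterlim_norm R_AbsRing C_R).
  - exists (Cmod (f (RtoC r * cis M)%C)). apply HM.
Qed.

Lemma derivative_eq_of_quadratic (f f' f1 : C -> C) (rho M : R) :
  derivative_on_disk f f' -> rho < 1 ->
  (forall z w, Cmod z <= rho -> Cmod w <= rho ->
     Cmod (f w - f z - f1 z * (w - z))%C <= M * Cmod (w - z)%C ^ 2) ->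
  forall z, Cmod z < rho -> f1 z = f' z.
Proof.
  intros Hf Hr H z Hz. apply (is_cderive_unique f z). 2: apply Hf; unfold in_disk; lra.
  apply (is_cderive_of_quadratic f z (f1 z) (rho - Cmod z) M). lra.
  intros w Hw. apply H. lra. pose proof (Cmod_minus_ge w z). lra.
Qed.

Lemma uniform_taylor (f f' : C -> C) (rho : R) :
  derivative_on_disk f f' -> 0 <= rho < 1 ->
  exists M, forall z w, Cmod z <= rho -> Cmod w <= rho ->
     Cmod (f w - f z - f' z * (w - z))%C <= M * Cmod (w - z)%C ^ 2.
Proof.
  (* The circle of radius [r] carries the Cauchy integral; [s] leaves room because [f1 = f'] is
     obtained only for [Cmod z < s], while [Cmod z] may equal [rho]. *)
  intros Hf Hr. set (s := (1 + 2 * rho) / 3). set (r := (2 + rho) / 3).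
  assert (rho < s < r) by (unfold s, r; lra). assert (r < 1) by (unfold r; lra).
  destruct (bounded_on_circle f f' r Hf ltac:(lra)) as [B HB].
  destruct (cauchy_taylor f f' r s B) as (f1 & f2 & _ & H1 & _); auto. 2: lra.
  { intros z Hz. apply Hf. unfold in_disk. lra. }
  exists (B * r / (r - s) ^ 3). intros z w Hz Hw.
  rewrite <- (derivative_eq_of_quadratic f f' f1 s _ Hf ltac:(lra) H1 z) by lra.
  apply H1; lra.
Qed.

Lemma derivative_is_analytic (f f' : C -> C) :
  derivative_on_disk f f' -> analytic_on_disk f'.
Proof.
  intros Hf z Hz. unfold in_disk in Hz. pose proof (Cmod_ge_0 z).
  set (s := (1 + 2 * Cmod z) / 3). set (r := (2 + Cmod z) / 3).
  assert (Cmod z < s < r) by (unfold s, r; lra). assert (r < 1) by (unfold r; lra).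
  destruct (bounded_on_circle f f' r Hf ltac:(lra)) as [B HB].
  destruct (cauchy_taylor f f' r s B) as (f1 & f2 & _ & T1 & T2); auto. 2: lra.
  { intros w Hw. apply Hf. unfold in_disk. lra. }
  pose proof (derivative_eq_of_quadratic f f' f1 s _ Hf ltac:(lra) T1) as E.
  exists (f2 z). eapply (is_cderive_of_quadratic _ _ _ (s - Cmod z)). lra.
  intros w Hw. assert (Cmod w < s) by (pose proof (Cmod_minus_ge w z); lra).
  rewrite <- !E by lra. apply T2; lra.
Qed.

(** The constant is [r / (r - rho)^2] with [r = 3/4] and [rho = 1/2]; it reappears in every division
    by [z]. *)
Lemma cauchy_estimate (f f' : C -> C) (B : R) :
  derivative_on_disk f f' -> (forall z, Cmod z = 3 / 4 -> Cmod (f z) <= B) ->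
  forall z, Cmod z < 1 / 2 -> Cmod (f' z) <= 12 * B.
Proof.
  intros Hf HB z Hz.
  destruct (cauchy_taylor f f' (3 / 4) (1 / 2) B) as (f1 & f2 & H0 & H1 & _).
  { intros w Hw. apply Hf. unfold in_disk. lra. } { lra. }
  { intros t _. apply HB. apply Cmod_circle. lra. }
  rewrite <- (derivative_eq_of_quadratic f f' f1 (1 / 2) _ Hf ltac:(lra) H1 z) by lra.
  eapply Rle_trans. apply H0. lra. right. field.
Qed.

(** * Integrals along rays *)

Definition cexp (z : C) : C := (RtoC (exp (fst z)) * cis (snd z))%C.

Lemma cexp_plus (z w : C) : cexp (z + w) = (cexp z * cexp w)%C.
Proof.
  unfold cexp, cis. simpl fst; simpl snd. rewrite exp_plus, cos_plus, sin_plus. cring.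
Qed.

Lemma cexp_0 : cexp 0 = RtoC 1.
Proof. unfold cexp, cis; simpl. rewrite exp_0, cos_0, sin_0. cring. Qed.

Lemma Cmod_cexp (z : C) : Cmod (cexp z) = exp (fst z).
Proof.
  unfold cexp. rewrite Cmod_mult, Cmod_cis, Cmod_RtoC_nonneg. ring. apply Rlt_le, exp_pos.
Qed.

Lemma cexp_nz (z : C) : cexp z <> RtoC 0.
Proof. apply Cmod_gt_0. rewrite Cmod_cexp. apply exp_pos. Qed.

Lemma cexp_opp (z : C) : (cexp z * cexp (- z))%C = RtoC 1.
Proof. rewrite <- cexp_plus, Cplus_opp_r. apply cexp_0. Qed.

Lemma cauchy_riemann (f : C -> C) (z d : C) :
  cdiff2 f (fst z) (snd z) d (Ci * d) -> is_cderive f z d.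
Proof.
  intros [_ H]. apply is_cderive_iff. intros eps.
  destruct z as [x y]. specialize (H (x, y) (fun P HP => HP) eps).
  apply (locally_C_Cmod (x, y)) in H. destruct H as [de Hd]. exists de.
  intros w Hw. specialize (Hd w Hw). rewrite norm_C_R in Hd.
  match type of Hd with Cmod ?e <= _ => replace e with (f w - f (x, y) - d * (w - (x, y)))%C in Hd end.
  - eapply Rle_trans. exact Hd. right. f_equal. apply norm_pair.
  - destruct w as [u v], d as [d1 d2]. cring.
Qed.

Lemma is_cderive_cexp (z : C) : is_cderive cexp z (cexp z).
Proof.
  apply cauchy_riemann. destruct z as [x y]. simpl fst; simpl snd.
  eapply cdiff2_eq. apply (cdiff2_mult (fun u => RtoC (exp (fst u))) (fun u => cis (snd u))).
  - apply (cdiff2_left (fun t => RtoC (exp t)) x y (RtoC (exp x))).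
    apply (is_rderive_pair exp (fun _ => 0)); auto_derive; auto; ring.
  - apply cdiff2_right. apply is_rderive_cis.
  - unfold cexp. simpl. ring.
  - unfold cexp. simpl. ring.
Qed.

(* The principal power [t^b] for [t > 0], extended by [0]. *)
Definition cpow (b : C) (t : R) : C :=
  if Rle_dec t 0 then RtoC 0 else cexp (b * RtoC (ln t)).

Lemma cpow_pos (b : C) (t : R) : 0 < t -> cpow b t = cexp (b * RtoC (ln t)).
Proof. intros H. unfold cpow. destruct (Rle_dec t 0); [lra | reflexivity]. Qed.

Lemma cpow_1 (b : C) : cpow b 1 = RtoC 1.
Proof. rewrite cpow_pos by lra. rewrite ln_1, Cmult_0_r. apply cexp_0. Qed.

(** [|t^b| = t^(Re b)], so the threshold is [eps^(1 / Re b)]. Small [eps] gives the behaviour at 0,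
    and [eps = 1] the bound on [0, 1]. *)
Lemma Cmod_cpow_le (b : C) (t eps : R) :
  0 < fst b -> 0 < eps -> t <= exp (ln eps / fst b) -> Cmod (cpow b t) <= eps.
Proof.
  intros Hb He Ht. unfold cpow. destruct (Rle_dec t 0). rewrite Cmod_0. lra.
  rewrite Cmod_cexp. simpl. rewrite Rmult_0_r, Rminus_0_r.
  rewrite <- (exp_ln eps He).
  enough (X : fst b * ln t <= ln eps) by (destruct X as [X | ->]; [apply Rlt_le, exp_increasing, X | apply Rle_refl]).
  apply Rnot_le_lt in n.
  assert (L : ln t <= ln eps / fst b).
  { rewrite <- (ln_exp (ln eps / fst b)). apply ln_le; auto. }
  apply (Rmult_le_compat_l (fst b)) in L. 2: lra.
  replace (fst b * (ln eps / fst b)) with (ln eps) in L by (field; lra). exact L.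
Qed.

Lemma Cmod_cpow_le_1 (b : C) (t : R) : 0 < fst b -> t <= 1 -> Cmod (cpow b t) <= 1.
Proof.
  intros Hb Ht. apply Cmod_cpow_le; auto. lra.
  rewrite ln_1. unfold Rdiv. rewrite Rmult_0_l, exp_0. lra.
Qed.

Lemma is_rderive_of_small_at_0 (f : R -> C) :
  (forall eps, 0 < eps -> exists d, 0 < d /\ forall t, Rabs t < d -> Cmod (f t) <= eps * Rabs t) ->
  is_rderive f 0 (RtoC 0).
Proof.
  intros H. split. apply is_linear_scal_l.
  intros x Hx eps.
  assert (E : 0 = x) by (apply (@is_filter_lim_locally_unique R_AbsRing R_NormedModule); exact Hx).
  subst x. destruct (H eps (cond_pos eps)) as (d & Hd & Hf).
  exists (mkposreal d Hd). intros t Ht.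
  assert (f 0 = RtoC 0).
  { apply Cmod_eq_0. apply Rle_antisym; [ | apply Cmod_ge_0].
    specialize (Hf 0). rewrite Rabs_R0, Rmult_0_r in Hf. auto. }
  assert (T : @minus R_AbsRing t 0 = t) by (unfold minus, plus, opp; simpl; ring).
  change (@norm R_AbsRing C_R (@minus C_R (@minus C_R (f t) (f 0)) (@scal R_AbsRing C_R (@minus R_AbsRing t 0) (RtoC 0)))
   <= eps * @norm R_AbsRing R_NormedModule (@minus R_AbsRing t 0)). rewrite norm_C_R.
  match goal with |- Cmod ?e <= _ => replace e with (f t) by (rewrite H0; destruct (f t); cring) end.
  rewrite T. apply Hf.
  assert (B : Rabs (@minus R_AbsRing t 0) < d) by exact Ht. now rewrite T in B.
Qed.

(** [s * s^b] stands for [s^(b + 1)]. At 0 the factor [s^b] tends to 0, and its extension by 0 to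
    negative [s] makes the derivative two-sided there; integration by parts uses this endpoint. *)
Lemma is_rderive_cpow (b : C) (t : R) :
  0 < fst b -> 0 <= t ->
  is_rderive (fun s => RtoC s * cpow b s)%C t ((b + 1) * cpow b t)%C.
Proof.
  intros Hb [Ht | <-].
  - eapply is_rderive_eq. apply is_rderive_mult. apply is_rderive_RtoC.
    apply (@is_derive_ext_loc R_AbsRing C_R (fun s => cexp (b * RtoC (ln s)))).
    { exists (mkposreal t Ht). intros s Hs. symmetry. apply cpow_pos.
      assert (A : Rabs (s - t) < t) by exact Hs. apply Rabs_lt_between in A. lra. }
    apply (is_rderive_comp cexp). apply is_cderive_cexp.
    apply is_rderive_scal. apply (is_rderive_pair ln (fun _ => 0) t (/ t) 0); auto_derive; auto; ring.
    rewrite cpow_pos by auto.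
    replace (((/ t)%R, 0) : C) with (/ RtoC t)%C by (rewrite <- RtoC_inv by lra; reflexivity).
    field. intros N. apply RtoC_inj in N. lra.
  - replace ((b + 1) * cpow b 0)%C with (RtoC 0).
    2: { unfold cpow. destruct (Rle_dec 0 0); [ring | lra]. }
    apply is_rderive_of_small_at_0. intros eps He. exists (exp (ln eps / fst b)).
    split. apply exp_pos. intros s Hs. rewrite Cmod_mult, Cmod_R, Rmult_comm.
    apply Rmult_le_compat_r. apply Rabs_pos. apply Cmod_cpow_le; auto.
    pose proof (Rle_abs s). lra.
Qed.

Lemma cpow_continuous (b : C) (t : R) : 0 < fst b -> 0 <= t -> ccontinuous (cpow b) t.
Proof.
  intros Hb [Ht | <-].
  - apply (@continuous_ext_loc R_UniformSpace C_R (cpow b) (fun s => cexp (b * RtoC (ln s))) t).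
    { exists (mkposreal t Ht). intros s Hs. symmetry. apply cpow_pos.
      assert (A : Rabs (s - t) < t) by exact Hs. apply Rabs_lt_between in A. lra. }
    eapply is_rderive_continuous. apply (is_rderive_comp cexp). apply is_cderive_cexp.
    apply is_rderive_scal. apply (is_rderive_pair ln (fun _ => 0) t (/ t) 0); auto_derive; auto; ring.
  - intros P HP. assert (Z : cpow b 0 = RtoC 0) by (unfold cpow; destruct (Rle_dec 0 0); [auto | lra]).
    rewrite Z in HP. apply locally_C_Cmod in HP. destruct HP as [de Hd].
    exists (mkposreal _ (exp_pos (ln (de / 2) / fst b))). intros s Hs. apply Hd.
    replace (cpow b s - 0)%C with (cpow b s) by ring.
    assert (A : Rabs (s - 0) < exp (ln (de / 2) / fst b)) by exact Hs.
    pose proof (cond_pos de). apply (Rle_lt_trans _ (de / 2)). 2: lra.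
    apply Cmod_cpow_le; auto. lra. pose proof (Rle_abs s). rewrite Rminus_0_r in A. lra.
Qed.

(** Common shape of the integral operators: weight 1 applied to [F'] gives the difference quotient
    at 0, [z] times weight 1 applied to [F] a primitive, and the weight [t^(b - 1)] solves the Euler
    equation. *)
Definition radial (om : R -> C) (F : C -> C) (z : C) : C :=
  CInt (fun t => om t * F (RtoC t * z))%C 0 1.

Lemma in_disk_ray (t : R) (z : C) : 0 <= t <= 1 -> in_disk z -> in_disk (RtoC t * z)%C.
Proof.
  unfold in_disk. intros Ht Hz. rewrite Cmod_mult, Cmod_RtoC_nonneg by lra.
  pose proof (Cmod_ge_0 z). nra.
Qed.

Lemma is_rderive_ray (F F' : C -> C) (t : R) (z : C) :
  derivative_on_disk F F' -> 0 <= t <= 1 -> in_disk z ->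
  is_rderive (fun s => F (RtoC s * z))%C t (z * F' (RtoC t * z))%C.
Proof.
  intros HF Ht Hz. eapply is_rderive_eq.
  apply (is_rderive_comp F). apply HF. now apply in_disk_ray.
  apply (is_rderive_mult RtoC (fun _ => z)). apply is_rderive_RtoC. apply is_rderive_const. ring.
Qed.

Lemma ray_continuous (F F' : C -> C) (t : R) (z : C) :
  derivative_on_disk F F' -> 0 <= t <= 1 -> in_disk z ->
  ccontinuous (fun s => F (RtoC s * z))%C t.
Proof. intros. eapply is_rderive_continuous, is_rderive_ray; eauto. Qed.

Lemma derivative_on_disk_exists (f : C -> C) :
  analytic_on_disk f -> exists f', derivative_on_disk f f'.
Proof. intros H. exists (C_derive f). now apply analytic_derivative. Qed.

(** The factor [t] comes from the chain rule. The Taylor remainder is uniform in [t] because [t z]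
    and [t w] stay in the closed disc of radius [(1 + |z|) / 2]. *)
Lemma radial_derivative (om : R -> C) (W : R) (F F' : C -> C) :
  (forall t, 0 <= t <= 1 -> ccontinuous om t) -> (forall t, 0 <= t <= 1 -> Cmod (om t) <= W) ->
  derivative_on_disk F F' ->
  derivative_on_disk (radial om F) (radial (fun t => om t * RtoC t)%C F').
Proof.
  intros Hc HW HF z Hz.
  destruct (derivative_on_disk_exists F') as [F'' HF'].
  { eapply derivative_is_analytic, HF. }
  unfold in_disk in Hz. pose proof (Cmod_ge_0 z).
  destruct (uniform_taylor F F' ((1 + Cmod z) / 2) HF ltac:(lra)) as [M HM].
  apply (is_cderive_of_quadratic _ _ _ ((1 - Cmod z) / 2) (W * Rabs M)). lra.
  intros w Hw. pose proof (Cmod_minus_ge w z).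
  assert (Hz' : in_disk z) by exact Hz. assert (Hw' : in_disk w) by (unfold in_disk; lra).
  rewrite (Cmult_comm _ (w - z)%C). unfold radial.
  replace (W * Rabs M * Cmod (w - z)%C ^ 2) with (W * Rabs M * Cmod (w - z)%C ^ 2 * (1 - 0)) by ring.
  apply CInt_remainder. lra.
  - intros t Ht. apply continuous_Cmult; auto. eapply ray_continuous; eauto.
  - intros t Ht. apply continuous_Cmult; auto. eapply ray_continuous; eauto.
  - intros t Ht. apply continuous_Cmult. 2: eapply ray_continuous; eauto.
    apply continuous_Cmult; auto. eapply is_rderive_continuous, is_rderive_RtoC.
  - intros t Ht.
    replace (om t * F (RtoC t * w) - om t * F (RtoC t * z) - (w - z) * (om t * RtoC t * F' (RtoC t * z)))%C
      with (om t * (F (RtoC t * w) - F (RtoC t * z) - F' (RtoC t * z) * (RtoC t * w - RtoC t * z)))%C by ring.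
    rewrite Cmod_mult, Rmult_assoc. apply Rmult_le_compat; try apply Cmod_ge_0; auto.
    eapply Rle_trans. apply HM; rewrite Cmod_mult, Cmod_RtoC_nonneg by lra.
    nra. pose proof (Cmod_ge_0 w); nra.
    replace (RtoC t * w - RtoC t * z)%C with (RtoC t * (w - z))%C by ring.
    rewrite Cmod_mult, Cmod_RtoC_nonneg by lra.
    pose proof (Rle_abs M). pose proof (Rabs_pos M). pose proof (Cmod_ge_0 (w - z)%C).
    assert (0 <= (t * Cmod (w - z)%C) ^ 2 <= Cmod (w - z)%C ^ 2).
    { split. apply pow2_ge_0. apply pow_incr. nra. }
    nra.
Qed.

(** Fundamental theorem of calculus for [th t * F (t z)] on [0, 1]. *)
Lemma radial_by_parts (th dth : R -> C) (F F' : C -> C) (z : C) :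
  derivative_on_disk F F' -> in_disk z ->
  (forall t, 0 <= t <= 1 -> is_rderive th t (dth t)) ->
  (forall t, 0 <= t <= 1 -> ccontinuous dth t) ->
  (radial dth F z + z * radial th F' z)%C = (th 1 * F z - th 0 * F 0)%C.
Proof.
  intros HF Hz Hth Hc.
  destruct (derivative_on_disk_exists F') as [F'' HF'].
  { eapply derivative_is_analytic, HF. }
  assert (Cth : forall t, 0 <= t <= 1 -> ccontinuous th t).
  { intros t Ht. eapply is_rderive_continuous; auto. }
  assert (A : forall t, 0 <= t <= 1 -> ccontinuous (fun t => dth t * F (RtoC t * z))%C t).
  { intros t Ht. apply continuous_Cmult; auto. eapply ray_continuous; eauto. }
  assert (B : forall t, 0 <= t <= 1 -> ccontinuous (fun t => th t * F' (RtoC t * z))%C t).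
  { intros t Ht. apply continuous_Cmult; auto. eapply ray_continuous; eauto. }
  assert (D : forall t, 0 <= t <= 1 -> ccontinuous (fun t => z * (th t * F' (RtoC t * z)))%C t).
  { intros t Ht. apply (continuous_Cmult _ (fun _ => z)). apply continuous_const. auto. }
  unfold radial. rewrite <- CInt_scal by (apply ex_CInt; auto; lra).
  rewrite <- CInt_plus by (apply ex_CInt; auto; lra).
  pose proof (@is_RInt_derive C_R (fun t => th t * F (RtoC t * z))%C
    (fun t => dth t * F (RtoC t * z) + z * (th t * F' (RtoC t * z)))%C 0 1) as H.
  rewrite Rmin_left, Rmax_right in H by lra.
  apply (@is_RInt_unique C_R) in H.
  - rewrite H. rewrite Cmult_1_l, Cmult_0_l. reflexivity.
  - intros t Ht. eapply is_rderive_eq. apply is_rderive_mult. now apply Hth. apply (is_rderive_ray F F' t z HF Ht Hz).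
    cbn beta. ring.
  - intros t Ht. apply (@continuous_plus R_UniformSpace R_AbsRing C_R (fun t => dth t * F (RtoC t * z))%C); auto.
Qed.

(** Integration by parts with weight 1. The mean of [F'] serves as [(F z - F 0) / z] with its
    analytic value at 0 included. *)
Lemma radial_difference_quotient (F F' : C -> C) (z : C) :
  derivative_on_disk F F' -> in_disk z ->
  (z * radial (fun _ => RtoC 1) F' z)%C = (F z - F 0)%C.
Proof.
  intros HF Hz.
  pose proof (radial_by_parts (fun _ => RtoC 1) (fun _ => RtoC 0) F F' z HF Hz
    (fun t _ => is_rderive_const _ t) (fun t _ => continuous_const _ t)) as H.
  replace (radial (fun _ => RtoC 0) F z) with (RtoC 0) in H.
  - rewrite Cplus_0_l in H. rewrite H. ring.
  - unfold radial. rewrite (CInt_ext _ (fun _ => RtoC 0)). rewrite CInt_const. ring. lra. intros; ring.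
Qed.

Lemma constant_of_zero_derivative (f : C -> C) :
  derivative_on_disk f (fun _ => RtoC 0) -> forall z, in_disk z -> f z = f 0.
Proof.
  intros Hf z Hz. apply Ceq_minus. rewrite <- (radial_difference_quotient f _ z Hf Hz).
  unfold radial. rewrite (CInt_ext _ (fun _ => RtoC 0)). rewrite CInt_const. ring. lra. intros; ring.
Qed.

Lemma radial_one_analytic (F F' : C -> C) :
  derivative_on_disk F F' -> analytic_on_disk (radial (fun _ => RtoC 1) F).
Proof.
  intros HF. eapply derivative_analytic, (radial_derivative _ 1 F F'); auto.
  intros t _. apply continuous_const. intros t _. rewrite Cmod_1. lra.
Qed.

Lemma radial_primitive (F F' : C -> C) :
  derivative_on_disk F F' -> derivative_on_disk (fun z => z * radial (fun _ => RtoC 1) F z)%C F.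
Proof.
  intros HF z Hz. eapply is_cderive_eq.
  - apply (is_cderive_mult (fun w => w)). apply is_cderive_id.
    apply (radial_derivative (fun _ => RtoC 1) 1 F F'); auto.
    intros t _. apply continuous_const. intros t _. rewrite Cmod_1. lra.
  - pose proof (radial_by_parts RtoC (fun _ => RtoC 1) F F' z HF Hz
      (fun t _ => is_rderive_RtoC t) (fun t _ => continuous_const _ t)) as H.
    assert (E : radial (fun t => RtoC 1 * RtoC t)%C F' z = radial RtoC F' z).
    { apply CInt_ext. lra. intros t _. ring. }
    rewrite E, Cmult_1_l, H. ring.
Qed.

(** * The Euler equation [z x' + b x = F] *)

Definition weight (alpha : R) (z : C) : R := Rpower (1 - Cmod z ^ 2) alpha.

(** A growth norm estimate kept as an inequality, so that no supremum has to be shown finite before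
    the passage to [bloch_norm]. *)
Definition weighted_bound (alpha : R) (F : C -> C) (K : R) : Prop :=
  forall z, in_disk z -> weight alpha z * Cmod (F z) <= K.

Lemma weight_pos (alpha : R) (z : C) : 0 < weight alpha z.
Proof. apply exp_pos. Qed.

Lemma weight_antitone (alpha : R) (z w : C) :
  0 <= alpha -> Cmod w <= Cmod z -> in_disk z -> weight alpha z <= weight alpha w.
Proof.
  unfold in_disk. intros Ha H Hz. pose proof (Cmod_ge_0 w). apply Rle_Rpower_l. lra. nra.
Qed.

Lemma weight_0 (alpha : R) : weight alpha 0 = 1.
Proof.
  unfold weight, Rpower. rewrite Cmod_0. replace (1 - 0 ^ 2) with 1 by ring.
  now rewrite ln_1, Rmult_0_r, exp_0.
Qed.

Lemma weight_le_1 (alpha : R) (z : C) : 0 <= alpha -> in_disk z -> weight alpha z <= 1.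
Proof.
  intros Ha Hz. rewrite <- (weight_0 alpha). apply weight_antitone; auto.
  rewrite Cmod_0. apply Cmod_ge_0.
Qed.

Lemma in_disk_0 : in_disk 0.
Proof. unfold in_disk. rewrite Cmod_0. lra. Qed.

Lemma weighted_bound_at_0 (alpha : R) (F : C -> C) (K : R) :
  weighted_bound alpha F K -> Cmod (F 0) <= K.
Proof. intros H. specialize (H _ in_disk_0). rewrite weight_0 in H. lra. Qed.

Lemma weighted_bound_nonneg (alpha : R) (F : C -> C) (K : R) :
  weighted_bound alpha F K -> 0 <= K.
Proof. intros H. eapply Rle_trans. apply Cmod_ge_0. eapply weighted_bound_at_0, H. Qed.

(** The weight at [t z] is at least the weight at [z], so a ray average with [|om| <= 1] keeps the
    bound. *)
Lemma radial_weighted_bound (alpha : R) (om : R -> C) (F F' : C -> C) (K : R) :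
  0 <= alpha -> derivative_on_disk F F' ->
  (forall t, 0 <= t <= 1 -> ccontinuous om t) -> (forall t, 0 <= t <= 1 -> Cmod (om t) <= 1) ->
  weighted_bound alpha F K -> weighted_bound alpha (radial om F) K.
Proof.
  intros Ha HF Hc Hom HK z Hz. pose proof (weight_pos alpha z).
  apply (Rmult_le_reg_l (/ weight alpha z)). now apply Rinv_0_lt_compat.
  rewrite <- Rmult_assoc, Rinv_l, Rmult_1_l by lra.
  replace (/ weight alpha z * K) with (/ weight alpha z * K * (1 - 0)) by ring.
  apply Cmod_CInt_le. lra.
  - intros t Ht. apply continuous_Cmult; auto. eapply ray_continuous; eauto.
  - intros t Ht. apply (Rmult_le_reg_l (weight alpha z)); auto.
    rewrite <- Rmult_assoc, Rinv_r, Rmult_1_l by lra.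
    pose proof (in_disk_ray t z Ht Hz) as Htz.
    eapply Rle_trans. 2: apply (HK _ Htz).
    apply Rmult_le_compat. lra. apply Cmod_ge_0.
    + apply weight_antitone; auto. rewrite Cmod_mult, Cmod_RtoC_nonneg by lra.
      pose proof (Cmod_ge_0 z). nra.
    + rewrite Cmod_mult. pose proof (Cmod_ge_0 (F (RtoC t * z)%C)). pose proof (Hom t Ht).
      pose proof (Cmod_ge_0 (om t)). nra.
Qed.

(** For [|z| >= 1/2], division by [z] costs a factor 2 on each of [F z] and [F 0], hence 4. For
    smaller [|z|] the quotient is a mean of [F'], estimated by Cauchy from the circle [|w| = 3/4],
    where the weight is [(7/16)^alpha]. *)
Lemma difference_quotient_weighted_bound (alpha : R) (F F' : C -> C) (K : R) :
  0 <= alpha -> derivative_on_disk F F' -> weighted_bound alpha F K ->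
  weighted_bound alpha (radial (fun _ => RtoC 1) F') ((4 + 12 / Rpower (7 / 16) alpha) * K).
Proof.
  intros Ha HF HK z Hz.
  pose proof (weighted_bound_nonneg _ _ _ HK) as K0. pose proof (weighted_bound_at_0 _ _ _ HK) as KF0.
  pose proof (weight_pos alpha z) as W0. pose proof (weight_le_1 alpha z Ha Hz) as W1.
  assert (P0 : 0 < Rpower (7 / 16) alpha) by apply exp_pos.
  assert (Q0 : 0 <= 12 / Rpower (7 / 16) alpha * K).
  { apply Rmult_le_pos; auto. apply Rlt_le, Rdiv_lt_0_compat; lra. }
  set (q := radial _ F' z).
  destruct (Rlt_le_dec (Cmod z) (1 / 2)) as [S|L].
  - destruct (derivative_on_disk_exists F') as [F'' HF']. { eapply derivative_is_analytic, HF. }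
    assert (Q : Cmod q <= 12 * (K / Rpower (7 / 16) alpha) * (1 - 0)).
    { apply Cmod_CInt_le. lra.
      - intros t Ht. apply continuous_Cmult. apply continuous_const. eapply ray_continuous; eauto.
      - intros t Ht. rewrite Cmult_1_l. apply (cauchy_estimate F F'); auto.
        + intros w Hw. specialize (HK w). unfold in_disk, weight in HK. rewrite Hw in HK.
          replace (1 - (3 / 4) ^ 2) with (7 / 16) in HK by field.
          apply (Rmult_le_reg_l (Rpower (7 / 16) alpha)); auto.
          replace (Rpower (7 / 16) alpha * (K / Rpower (7 / 16) alpha)) with K by (field; lra).
          apply HK. lra.
        + rewrite Cmod_mult, Cmod_RtoC_nonneg by lra. pose proof (Cmod_ge_0 z). nra. }
    replace (12 * (K / Rpower (7 / 16) alpha) * (1 - 0)) with (12 / Rpower (7 / 16) alpha * K) in Q by (field; lra).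
    pose proof (Cmod_ge_0 q). nra.
  - assert (E : Cmod z * Cmod q = Cmod (F z - F 0)%C).
    { rewrite <- Cmod_mult. f_equal. now apply (radial_difference_quotient F F' z). }
    pose proof (Cmod_triangle (F z) (- F 0)%C) as T. rewrite Cmod_opp in T.
    fold (Cminus (F z) (F 0)) in T. rewrite <- E in T.
    pose proof (Cmod_ge_0 q). pose proof (Cmod_ge_0 (F 0)). specialize (HK z Hz).
    assert (Cmod q <= 2 * Cmod (F z) + 2 * Cmod (F 0)) by nra.
    assert (weight alpha z * Cmod q <= 2 * (weight alpha z * Cmod (F z)) + 2 * (weight alpha z * Cmod (F 0))) by nra.
    assert (weight alpha z * Cmod (F 0) <= K) by nra. lra.
Qed.

(** [K] is chosen before [F]; this uniformity becomes the boundedness of the inverse operator. *)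
Definition euler_solvable (alpha : R) (b : C) : Prop :=
  exists K, 0 <= K /\ forall (F F' : C -> C) (k : R),
    derivative_on_disk F F' -> weighted_bound alpha F k ->
    exists x x' : C -> C, derivative_on_disk x x' /\
      (forall z, in_disk z -> (z * x' z + b * x z)%C = F z) /\ weighted_bound alpha x (K * k).

(** Integration by parts with [th t = t^b], written [t * t^(b - 1)]; the kernel has modulus at most
    1, so [K = 1]. *)
Lemma euler_solvable_base (alpha : R) (b : C) : 0 <= alpha -> 1 < fst b -> euler_solvable alpha b.
Proof.
  intros Ha Hb. exists 1. split. lra. intros F F' k HF Hk.
  assert (Hb1 : 0 < fst (b - 1)%C) by (simpl; lra).
  exists (radial (cpow (b - 1)) F), (radial (fun t => cpow (b - 1) t * RtoC t)%C F').
  split; [ | split].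
  - apply (radial_derivative _ 1); auto.
    + intros t Ht. apply cpow_continuous; lra.
    + intros t Ht. apply Cmod_cpow_le_1; lra.
  - intros z Hz.
    pose proof (radial_by_parts (fun t => RtoC t * cpow (b - 1) t)%C (fun t => (b - 1 + 1) * cpow (b - 1) t)%C
      F F' z HF Hz) as H.
    cbn beta in H. rewrite cpow_1 in H.
    replace (radial (fun t => (b - 1 + 1) * cpow (b - 1) t)%C F z) with (b * radial (cpow (b - 1)) F z)%C in H.
    + replace (radial (fun t => cpow (b - 1) t * RtoC t)%C F' z) with
        (radial (fun t => RtoC t * cpow (b - 1) t)%C F' z).
      * rewrite Cplus_comm, H. ring.
        -- intros t Ht. apply is_rderive_cpow; lra.
        -- intros t Ht. apply (continuous_Cmult _ (fun _ => (b - 1 + 1)%C)). apply continuous_const.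
           apply cpow_continuous; lra.
      * apply CInt_ext. lra. intros t _. ring.
    + unfold radial. rewrite <- CInt_scal.
      * apply CInt_ext. lra. intros t _. ring.
      * apply ex_CInt. lra. intros t Ht. apply continuous_Cmult. apply cpow_continuous; lra.
        eapply ray_continuous; eauto.
  - rewrite Rmult_1_l. apply (radial_weighted_bound alpha _ F F'); auto.
    + intros t Ht. apply cpow_continuous; lra.
    + intros t Ht. apply Cmod_cpow_le_1; lra.
Qed.

(* Substituting [x = F 0 / b + z y] turns the equation into [z y' + (b + 1) y = (F - F 0) / z]. *)
Lemma euler_solvable_step (alpha : R) (b : C) :
  0 <= alpha -> b <> RtoC 0 -> euler_solvable alpha (b + 1)%C -> euler_solvable alpha b.
Proof.
  intros Ha Hb [K [HK H]].
  assert (B0 : 0 < Cmod b) by now apply Cmod_gt_0.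
  assert (P0 : 0 < 12 / Rpower (7 / 16) alpha) by (apply Rdiv_lt_0_compat; [lra | apply exp_pos]).
  set (c := 4 + 12 / Rpower (7 / 16) alpha) in *. assert (c > 0) by (unfold c; lra).
  (* [/ Cmod b] pays for the constant [F 0 / b], [c] for the difference quotient and [K] for solving
     with [b + 1]. *)
  exists (/ Cmod b + K * c). split.
  { apply Rinv_0_lt_compat in B0. nra. }
  intros F F' k HF Hk.
  destruct (derivative_on_disk_exists F') as [F'' HF']. { eapply derivative_is_analytic, HF. }
  destruct (derivative_on_disk_exists (radial (fun _ => RtoC 1) F')) as [q' Hq].
  { eapply radial_one_analytic, HF'. }
  destruct (H _ _ _ Hq (difference_quotient_weighted_bound alpha F F' k Ha HF Hk)) as (y & y' & Hy & Ey & By).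
  exists (fun z => F 0 * / b + z * y z)%C, (fun z => y z + z * y' z)%C. split; [ | split].
  - intros z Hz. eapply is_cderive_eq. apply is_cderive_plus. apply is_cderive_const.
    apply is_cderive_mult. apply is_cderive_id. now apply Hy. cbn beta. ring.
  - intros z Hz. transitivity (F 0 + z * (z * y' z + (b + 1) * y z))%C. field. auto.
    rewrite Ey by auto. rewrite (radial_difference_quotient F F' z HF Hz). ring.
  - intros z Hz. specialize (By z Hz). pose proof (weighted_bound_at_0 _ _ _ Hk).
    pose proof (weight_pos alpha z). pose proof (weight_le_1 alpha z Ha Hz).
    eapply Rle_trans. apply Rmult_le_compat_l. lra. apply Cmod_triangle.
    rewrite !Cmod_mult, Cmod_inv by auto. pose proof (Cmod_ge_0 (F 0)). pose proof (Cmod_ge_0 (y z)).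
    pose proof (Cmod_ge_0 z). unfold in_disk in Hz.
    fold c in By. assert (B1 : 0 < / Cmod b) by now apply Rinv_0_lt_compat.
    assert (weight alpha z * (Cmod (F 0) * / Cmod b) <= / Cmod b * k).
    { replace (/ Cmod b * k) with (k * / Cmod b) by ring. rewrite <- Rmult_assoc.
      apply Rmult_le_compat_r. lra. nra. }
    assert (weight alpha z * (Cmod z * Cmod (y z)) <= weight alpha z * Cmod (y z)).
    { apply Rmult_le_compat_l. lra. nra. }
    nra.
Qed.

(** Induction on the number of shifts that bring the real part above 1. Avoiding 0, -1, -2, ...
    passes from [b] to [b + 1] and permits each division by [b]. *)
Lemma euler_solvable_all (alpha : R) (b : C) :
  0 <= alpha -> (forall n : nat, b <> RtoC (- INR n)) -> euler_solvable alpha b.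
Proof.
  intros Ha.
  assert (G : forall n b, 1 < fst b + INR n -> (forall n : nat, b <> RtoC (- INR n)) -> euler_solvable alpha b).
  { clear b. induction n as [|n IH]; intros b Hn Hb.
    - apply euler_solvable_base; auto. simpl in Hn. lra.
    - apply euler_solvable_step; auto.
      + specialize (Hb O). simpl in Hb. now rewrite Ropp_0 in Hb.
      + apply IH. rewrite S_INR in Hn. simpl. lra.
        intros m E. apply (Hb (S m)). rewrite S_INR.
        replace b with (b + 1 - 1)%C by ring. rewrite E. rewrite <- RtoC_minus. f_equal. ring. }
  intros Hb. destruct (INR_unbounded (1 - fst b)) as [n Hn]. apply (G n); auto. lra.
Qed.

(** The quotient is the radial mean of [f']. The bound through [f'] serves Bloch functions; the one
    through [f] serves [g - g 0], of which only boundedness is known. *)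
Lemma analytic_division_at_0 (f f' : C -> C) :
  derivative_on_disk f f' -> f 0 = RtoC 0 ->
  exists q q' : C -> C, derivative_on_disk q q' /\ (forall z, in_disk z -> f z = (z * q z)%C) /\
    (forall alpha K, 0 <= alpha -> weighted_bound alpha f' K -> weighted_bound alpha q K) /\
    (forall alpha K, 0 <= alpha -> weighted_bound alpha f K ->
       weighted_bound alpha q ((4 + 12 / Rpower (7 / 16) alpha) * K)).
Proof.
  intros Hf H0.
  destruct (derivative_on_disk_exists f') as [f'' Hf']. { eapply derivative_is_analytic, Hf. }
  destruct (derivative_on_disk_exists (radial (fun _ => RtoC 1) f')) as [q' Hq].
  { eapply radial_one_analytic, Hf'. }
  exists (radial (fun _ => RtoC 1) f'), q'. split; [ | split; [ | split]]; auto.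
  - intros z Hz. rewrite (radial_difference_quotient f f' z Hf Hz), H0. ring.
  - intros alpha K Ha HK. apply (radial_weighted_bound alpha _ f' f''); auto.
    intros t _. apply continuous_const. intros t _. rewrite Cmod_1. lra.
  - intros alpha K Ha HK. now apply (difference_quotient_weighted_bound alpha f).
Qed.

Lemma derivative_of_id_mult (q q' : C -> C) (z : C) :
  derivative_on_disk q q' -> in_disk z -> is_cderive (fun w => w * q w)%C z (q z + z * q' z)%C.
Proof.
  intros Hq Hz. eapply is_cderive_eq. apply is_cderive_mult. apply is_cderive_id. now apply Hq. cbn beta. ring.
Qed.

Lemma is_cderive_ext_on_disk (f g : C -> C) (z d : C) :
  in_disk z -> eq_on_disk f g -> is_cderive f z d -> is_cderive g z d.
Proof.
  intros Hz E. apply (is_cderive_ext_loc f g z d (1 - Cmod z)). unfold in_disk in Hz. lra.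
  intros w Hw. apply E. unfold in_disk. pose proof (Cmod_minus_ge w z). lra.
Qed.

(** At 0, where division fails, [f 0] is the derivative of [w * f w], a function that vanishes on
    the disc. *)
Lemma analytic_cancel_id (f f' : C -> C) :
  derivative_on_disk f f' -> (forall z, in_disk z -> (z * f z)%C = RtoC 0) ->
  forall z, in_disk z -> f z = RtoC 0.
Proof.
  intros Hf H z Hz. destruct (Ceq_dec z 0) as [->|N].
  - assert (E : (f 0 + 0 * f' 0)%C = RtoC 0); [ | now rewrite Cmult_0_l, Cplus_0_r in E ].
    apply (is_cderive_unique (fun w => w * f w)%C 0).
    now apply derivative_of_id_mult.
    apply (is_cderive_ext_on_disk (fun _ => RtoC 0)); auto. 2: apply is_cderive_const.
    intros w Hw. symmetry. now apply H.
  - specialize (H z Hz). apply NNPP. intros M. now apply (Cmult_neq_0 z (f z)).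
Qed.

(** The derivative of [t^b x(t z)] in [t] is [t^(b - 1)] times the Euler expression at [t z], hence
    0; the function is 0 at [t = 0] and [x z] at [t = 1]. *)
Lemma euler_unique_base (b : C) (x x' : C -> C) :
  1 < fst b -> derivative_on_disk x x' ->
  (forall z, in_disk z -> (z * x' z + b * x z)%C = RtoC 0) ->
  forall z, in_disk z -> x z = RtoC 0.
Proof.
  intros Hb Hx H z Hz.
  assert (Hb1 : 0 < fst (b - 1)%C) by (simpl; lra).
  pose proof (@is_RInt_derive C_R (fun t => (RtoC t * cpow (b - 1) t) * x (RtoC t * z))%C
    (fun _ => RtoC 0) 0 1) as D.
  rewrite Rmin_left, Rmax_right in D by lra.
  apply (@is_RInt_unique C_R) in D.
  - rewrite (CInt_const 0) in D. rewrite cpow_1 in D.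
    transitivity (minus (RtoC 1 * RtoC 1 * x (RtoC 1 * z))%C (RtoC 0 * cpow (b - 1) 0 * x (RtoC 0 * z))%C).
    + rewrite !Cmult_1_l, !Cmult_0_l. change (x z = x z - 0)%C. ring.
    + transitivity (RtoC (1 - 0) * 0)%C. symmetry. exact D. ring.
  - intros t Ht. eapply is_rderive_eq. apply is_rderive_mult.
    apply is_rderive_cpow; lra. apply (is_rderive_ray x x' t z Hx Ht Hz).
    cbn beta. replace ((b - 1 + 1) * cpow (b - 1) t * x (RtoC t * z) + RtoC t * cpow (b - 1) t * (z * x' (RtoC t * z)))%C
      with (cpow (b - 1) t * (RtoC t * z * x' (RtoC t * z) + b * x (RtoC t * z)))%C by ring.
    rewrite H by now apply in_disk_ray. ring.
  - intros t Ht. apply continuous_const.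
Qed.

(** At the origin the equation reads [b x(0) = 0], so [x = z y] and [z (z y' + (b + 1) y) = 0];
    cancelling [z] raises [b] towards the base case. *)
Lemma euler_unique (b : C) (x x' : C -> C) :
  (forall n : nat, b <> RtoC (- INR n)) -> derivative_on_disk x x' ->
  (forall z, in_disk z -> (z * x' z + b * x z)%C = RtoC 0) ->
  forall z, in_disk z -> x z = RtoC 0.
Proof.
  assert (G : forall n b (x x' : C -> C), 1 < fst b + INR n ->
    (forall n : nat, b <> RtoC (- INR n)) -> derivative_on_disk x x' ->
    (forall z, in_disk z -> (z * x' z + b * x z)%C = RtoC 0) ->
    forall z, in_disk z -> x z = RtoC 0).
  { clear. induction n as [|n IH]; intros b x x' Hn Hb Hx H z Hz.
    - apply (euler_unique_base b x x'); auto. simpl in Hn. lra.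
    - assert (b <> RtoC 0). { specialize (Hb O). simpl in Hb. now rewrite Ropp_0 in Hb. }
      assert (X0 : x 0 = RtoC 0).
      { specialize (H _ in_disk_0). rewrite Cmult_0_l, Cplus_0_l in H.
        apply NNPP. intros N. now apply (Cmult_neq_0 b (x 0)). }
      destruct (analytic_division_at_0 x x' Hx X0) as (y & y' & Hy & Exy & _).
      rewrite Exy by auto. rewrite (IH (b + 1)%C y y'); auto.
      + ring.
      + rewrite S_INR in Hn. simpl. lra.
      + intros m E. apply (Hb (S m)). rewrite S_INR.
        replace b with (b + 1 - 1)%C by ring. rewrite E. rewrite <- RtoC_minus. f_equal. ring.
      + destruct (derivative_on_disk_exists y') as [y'' Hy']. { eapply derivative_is_analytic, Hy. }
        apply (analytic_cancel_id _ (fun z => (y' z + z * y'' z) + (b + 1) * y' z)%C).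
        * intros w Hw. apply (is_cderive_plus (fun w => w * y' w)%C (fun w => (b + 1) * y w)%C).
          now apply derivative_of_id_mult. apply is_cderive_scal. now apply Hy.
        * intros w Hw. rewrite <- (H w Hw).
          rewrite (is_cderive_unique x w (x' w) (y w + w * y' w)%C).
          -- rewrite (Exy w Hw). ring.
          -- now apply Hx.
          -- apply (is_cderive_ext_on_disk (fun w => w * y w)%C); auto.
             intros v Hv. symmetry. now apply Exy. now apply derivative_of_id_mult. }
  intros Hb. destruct (INR_unbounded (1 - fst b)) as [n Hn]. apply (G n); auto. lra.
Qed.

(** * Bloch norms and the Alexander operator *)

(** [bloch_norm] is [real] of a supremum in [Rbar], so infinite values must be excluded: [p_infty]
    by the upper bound [K], [m_infty] by the value at [z = 0]. *)
Lemma bloch_of_weighted_bound (alpha : R) (f f' : C -> C) (K : R) :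
  derivative_on_disk f f' -> weighted_bound alpha f' K ->
  in_bloch alpha f /\ bloch_norm alpha f <= K.
Proof.
  intros Hf HK. unfold in_bloch, bloch_norm.
  destruct (Lub_Rbar_correct (fun r => exists z d, in_disk z /\ is_cderive f z d /\
     r = Rpower (1 - Cmod z ^ 2) alpha * Cmod d)) as [Ub Least].
  fold (bloch_sup alpha f) in Ub, Least.
  specialize (Ub (weight alpha 0 * Cmod (f' 0))). specialize (Least (Finite K)).
  destruct (bloch_sup alpha f) as [s | | ].
  - split. split. eapply derivative_analytic, Hf. reflexivity.
    simpl. apply Least. intros r (z & d & Hz & Hd & ->). simpl.
    rewrite (is_cderive_unique f z d (f' z) Hd (Hf z Hz)). now apply HK.
  - exfalso. apply Least. intros r (z & d & Hz & Hd & ->). simpl.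
    rewrite (is_cderive_unique f z d (f' z) Hd (Hf z Hz)). now apply HK.
  - exfalso. apply Ub. exists (RtoC 0), (f' 0). split. apply in_disk_0. split. apply Hf, in_disk_0. reflexivity.
Qed.

Lemma weighted_bound_of_bloch (alpha : R) (f f' : C -> C) :
  in_bloch alpha f -> derivative_on_disk f f' -> weighted_bound alpha f' (bloch_norm alpha f).
Proof.
  intros [_ Hfin] Hf z Hz. unfold bloch_norm.
  destruct (Lub_Rbar_correct (fun r => exists z d, in_disk z /\ is_cderive f z d /\
     r = Rpower (1 - Cmod z ^ 2) alpha * Cmod d)) as [Ub _].
  fold (bloch_sup alpha f) in Ub.
  specialize (Ub (weight alpha z * Cmod (f' z))). rewrite <- Hfin in Ub. apply Ub.
  exists z, (f' z). split; auto.
Qed.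

Lemma bloch_norm_nonneg (alpha : R) (f : C -> C) : in_bloch alpha f -> 0 <= bloch_norm alpha f.
Proof.
  intros Hf. destruct (derivative_on_disk_exists f (proj1 Hf)) as [f' Hf'].
  eapply weighted_bound_nonneg, weighted_bound_of_bloch; eauto.
Qed.

Lemma bloch_norm_le_of_eq_on_disk (alpha : R) (f g : C -> C) :
  in_bloch alpha g -> eq_on_disk g f -> bloch_norm alpha f <= bloch_norm alpha g.
Proof.
  intros Hg E. destruct (derivative_on_disk_exists g (proj1 Hg)) as [g' Hg'].
  apply (bloch_of_weighted_bound alpha f g').
  - intros z Hz. apply (is_cderive_ext_on_disk g); auto.
  - now apply weighted_bound_of_bloch.
Qed.

Lemma bloch0_eq_0_of_norm_le_0 (alpha : R) (f : C -> C) :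
  in_bloch0 alpha f -> bloch_norm alpha f <= 0 -> forall z, in_disk z -> f z = RtoC 0.
Proof.
  intros [Hf H0] N z Hz. destruct (derivative_on_disk_exists f (proj1 Hf)) as [f' Hf'].
  rewrite <- H0. apply (constant_of_zero_derivative f); auto.
  intros w Hw. replace (RtoC 0) with (f' w). now apply Hf'.
  pose proof (weighted_bound_of_bloch alpha f f' Hf Hf' w Hw). pose proof (weight_pos alpha w).
  apply Cmod_eq_0. pose proof (Cmod_ge_0 (f' w)). nra.
Qed.

Lemma eq_on_disk_of_derivative (f g d : C -> C) :
  derivative_on_disk f d -> derivative_on_disk g d -> f 0 = g 0 -> eq_on_disk f g.
Proof.
  intros Hf Hg H0 z Hz. apply Ceq_minus.
  rewrite (constant_of_zero_derivative (fun z => f z - g z)%C); auto.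
  - rewrite H0. ring.
  - intros w Hw. eapply is_cderive_eq. apply is_cderive_minus; auto. ring.
Qed.

Lemma derivative_on_disk_mult (f f' g g' : C -> C) :
  derivative_on_disk f f' -> derivative_on_disk g g' ->
  derivative_on_disk (fun z => f z * g z)%C (fun z => f' z * g z + f z * g' z)%C.
Proof. intros Hf Hg z Hz. apply is_cderive_mult; auto. Qed.

(** * The Alexander operator through its derivative *)

Lemma alexander_op_0 (g f : C -> C) : alexander_op g f 0 = RtoC 0.
Proof.
  unfold alexander_op. rewrite (CInt_ext _ (fun _ => RtoC 0)).
  rewrite CInt_const. ring. lra. intros t _. apply Cmult_0_r.
Qed.

(** With [f = z q] the quotient [f g / w] is [q g] for [0 < t < 1], so the operator yields the
    radial primitive of [q g]. The undefined quotient at [t = 0] does not affect the integral;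
    [z = 0] is treated apart. *)
Lemma alexander_op_derivative (g g' f q q' : C -> C) :
  derivative_on_disk g g' -> derivative_on_disk q q' -> (forall z, in_disk z -> f z = (z * q z)%C) ->
  derivative_on_disk (alexander_op g f) (fun z => q z * g z)%C.
Proof.
  intros Hg Hq Ef z Hz.
  pose proof (derivative_on_disk_mult q q' g g' Hq Hg) as HF.
  apply (is_cderive_ext_on_disk (fun z => z * radial (fun _ => RtoC 1) (fun w => q w * g w) z)%C); auto.
  2: now apply (radial_primitive _ _ HF).
  clear z Hz. intros z Hz. destruct (Ceq_dec z 0) as [->|N].
  - rewrite alexander_op_0. ring.
  - unfold alexander_op, radial. rewrite <- CInt_scal.
    + apply CInt_ext. lra. intros t Ht. rewrite Ef by (apply in_disk_ray; auto; lra).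
      assert (RtoC t <> RtoC 0) by (intros M; apply RtoC_inj in M; lra). field. auto.
    + apply ex_CInt. lra. intros t Ht. apply (continuous_Cmult _ (fun _ => RtoC 1)). apply continuous_const.
      apply (ray_continuous _ _ t z HF Ht Hz).
Qed.

Lemma op_shift_derivative (lam : C) (g g' f f' q q' : C -> C) :
  derivative_on_disk g g' -> derivative_on_disk f f' -> derivative_on_disk q q' ->
  (forall z, in_disk z -> f z = (z * q z)%C) ->
  derivative_on_disk (op_shift (alexander_op g) lam f) (fun z => q z * g z - lam * f' z)%C.
Proof.
  intros Hg Hf Hq Ef z Hz. apply (is_cderive_minus (alexander_op g f) (fun z => lam * f z)%C).
  now apply (alexander_op_derivative g g' f q q'). apply is_cderive_scal. now apply Hf.
Qed.

Lemma op_shift_0 (lam : C) (g f : C -> C) : f 0 = RtoC 0 -> op_shift (alexander_op g) lam f 0 = RtoC 0.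
Proof. intros H. unfold op_shift. rewrite alexander_op_0, H. ring. Qed.

(** [f / z] is a radial mean of [f'] and obeys the same weighted bound; with [|g| <= M] this
    controls the derivative [q g - lam f']. *)
Lemma op_shift_in_bloch0 (alpha M : R) (lam : C) (g g' f : C -> C) :
  0 <= alpha -> derivative_on_disk g g' -> (forall z, in_disk z -> Cmod (g z) <= M) ->
  in_bloch0 alpha f -> in_bloch0 alpha (op_shift (alexander_op g) lam f).
Proof.
  intros Ha Hg HM [Hf H0].
  destruct (derivative_on_disk_exists f (proj1 Hf)) as [f' Hf'].
  destruct (analytic_division_at_0 f f' Hf' H0) as (q & q' & Hq & Ef & Bq & _).
  pose proof (weighted_bound_of_bloch alpha f f' Hf Hf') as Bf. specialize (Bq alpha _ Ha Bf).
  split. 2: now apply op_shift_0.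
  apply (bloch_of_weighted_bound alpha _ _ (bloch_norm alpha f * M + Cmod lam * bloch_norm alpha f)
    (op_shift_derivative lam g g' f f' q q' Hg Hf' Hq Ef)).
  intros z Hz. specialize (Bf z Hz). specialize (Bq z Hz). specialize (HM z Hz).
  pose proof (weight_pos alpha z).
  eapply Rle_trans. apply Rmult_le_compat_l. lra. apply Cmod_triangle.
  rewrite Cmod_opp, !Cmod_mult, Rmult_plus_distr_l. apply Rplus_le_compat.
  - rewrite <- Rmult_assoc. apply Rmult_le_compat; auto using Cmod_ge_0.
    apply Rmult_le_pos; auto using Cmod_ge_0. lra.
  - rewrite <- Rmult_assoc, (Rmult_comm _ (Cmod lam)), Rmult_assoc. apply Rmult_le_compat_l; auto using Cmod_ge_0.
Qed.

(* The integrating factor [exp (int_0^z (g w - g 0) / (lam w) dw)]. *)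
Lemma integrating_factor (M : R) (lam : C) (g g' : C -> C) :
  lam <> RtoC 0 -> derivative_on_disk g g' -> (forall z, in_disk z -> Cmod (g z) <= M) ->
  exists (E E' : C -> C) (B : R), derivative_on_disk E E' /\
    (forall z, E z <> RtoC 0) /\
    (forall z, in_disk z -> Cmod (E z) <= B /\ Cmod (/ E z) <= B /\
       (lam * (z * E' z))%C = ((g z - g 0) * E z)%C).
Proof.
  intros Hl Hg HM. pose proof (HM _ in_disk_0) as HM0. pose proof (Cmod_ge_0 (g 0)).
  assert (Hd : derivative_on_disk (fun z => g z - g 0)%C g').
  { intros z Hz. eapply is_cderive_eq. apply is_cderive_minus. now apply Hg. apply is_cderive_const. ring. }
  destruct (analytic_division_at_0 _ g' Hd) as (p & p' & Hp & Ep & _ & Bp). ring.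
  pose proof (radial_primitive p p' Hp) as HG.
  set (G := fun z => (z * radial (fun _ => RtoC 1) p z)%C) in *.
  (* With exponent 0 the weight is 1, so weighted bounds are sup bounds: [2 M] bounds [g - g 0], and
     the other factor is the cost of dividing by [z]. *)
  set (K := (4 + 12 / Rpower (7 / 16) 0) * (2 * M)).
  assert (BG : forall z, in_disk z -> Cmod (G z) <= K).
  { intros z Hz. assert (W : forall z, in_disk z -> weight 0 z = 1).
    { intros w Hw. apply Rpower_O. unfold in_disk in Hw. pose proof (Cmod_ge_0 w). nra. }
    assert (B : weighted_bound 0 (radial (fun _ => RtoC 1) p) K).
    { apply (radial_weighted_bound 0 _ p p'); auto. lra. intros t _. apply continuous_const.
      intros t _. rewrite Cmod_1. lra. apply Bp. lra.
      intros w Hw. rewrite W, Rmult_1_l by auto. eapply Rle_trans. apply Cmod_triangle.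
      rewrite Cmod_opp. specialize (HM w Hw). lra. }
    specialize (B z Hz). rewrite W, Rmult_1_l in B by auto.
    unfold G. rewrite Cmod_mult. pose proof (Cmod_ge_0 z).
    pose proof (Cmod_ge_0 (radial (fun _ => RtoC 1) p z)). unfold in_disk in Hz. nra. }
  (* Only the modulus of the exponent enters, so one bound covers both [E] and [/ E]. *)
  assert (BR : forall z w, in_disk z -> Cmod w = Cmod (G z) / Cmod lam -> Cmod (cexp w) <= exp (K / Cmod lam)).
  { intros z w Hz Hw. rewrite Cmod_cexp.
    assert (X : fst w <= K / Cmod lam).
    { eapply Rle_trans. apply Rle_abs. eapply Rle_trans. apply re_le_Cmod. rewrite Hw.
      apply Rmult_le_compat_r. apply Rlt_le, Rinv_0_lt_compat. now apply Cmod_gt_0. auto. }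
    destruct X as [X | ->]; [apply Rlt_le, exp_increasing, X | apply Rle_refl]. }
  exists (fun z => cexp (/ lam * G z)), (fun z => / lam * p z * cexp (/ lam * G z))%C, (exp (K / Cmod lam)).
  split; [ | split].
  - intros z Hz. apply (is_cderive_comp cexp). apply is_cderive_cexp. apply is_cderive_scal. now apply HG.
  - intros z. apply cexp_nz.
  - intros z Hz. split; [ | split].
    + apply (BR z); auto. rewrite Cmod_mult, Cmod_inv by auto. unfold Rdiv. ring.
    + replace (/ cexp (/ lam * G z))%C with (cexp (- (/ lam * G z)))%C.
      * apply (BR z); auto. rewrite Cmod_opp, Cmod_mult, Cmod_inv by auto. unfold Rdiv. ring.
      * pose proof (cexp_opp (/ lam * G z)) as X. pose proof (cexp_nz (/ lam * G z)) as Y.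
        transitivity (/ cexp (/ lam * G z) * (cexp (/ lam * G z) * cexp (- (/ lam * G z))))%C.
        field. auto. rewrite X. ring.
    + rewrite Ep by auto. field. auto.
Qed.

Lemma weighted_bound_scal (alpha K : R) (c : C) (F : C -> C) :
  weighted_bound alpha F K -> weighted_bound alpha (fun z => c * F z)%C (Cmod c * K).
Proof.
  intros H z Hz. rewrite Cmod_mult, <- Rmult_assoc, (Rmult_comm _ (Cmod c)), Rmult_assoc.
  apply Rmult_le_compat_l; auto using Cmod_ge_0.
Qed.

Lemma weighted_bound_mult (alpha K B : R) (F H : C -> C) :
  weighted_bound alpha F K -> (forall z, in_disk z -> Cmod (H z) <= B) ->
  weighted_bound alpha (fun z => F z * H z)%C (K * B).
Proof.
  intros HF HB z Hz. rewrite Cmod_mult, <- Rmult_assoc. pose proof (weight_pos alpha z).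
  apply Rmult_le_compat; auto using Cmod_ge_0. apply Rmult_le_pos; auto using Cmod_ge_0. lra.
Qed.

Lemma weighted_bound_plus (alpha K L : R) (F H : C -> C) :
  weighted_bound alpha F K -> weighted_bound alpha H L ->
  weighted_bound alpha (fun z => F z + H z)%C (K + L).
Proof.
  intros HF HH z Hz. specialize (HF z Hz). specialize (HH z Hz). pose proof (weight_pos alpha z).
  pose proof (Cmod_triangle (F z) (H z)). nra.
Qed.

(** * Conjugation by the integrating factor *)

Section Conjugation.

Variables (alpha M B : R) (lam : C) (g g' E E' : C -> C).
Hypothesis Ha : 0 <= alpha.
Hypothesis Hl : lam <> RtoC 0.
Hypothesis Hg : derivative_on_disk g g'.
Hypothesis HM : forall z, in_disk z -> Cmod (g z) <= M.
Hypothesis HE : derivative_on_disk E E'.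
Hypothesis E0 : forall z, E z <> RtoC 0.
Hypothesis Eb : forall z, in_disk z -> Cmod (E z) <= B /\ Cmod (/ E z) <= B /\
       (lam * (z * E' z))%C = ((g z - g 0) * E z)%C.

Let b : C := (1 - g 0 / lam)%C.

(** Since [lam z E' = (g - g 0) E], every [x'] is absorbed into the Euler expression; the Bloch norm
    of [z E x] is then controlled by [x] and [z x' + b x]. *)
Lemma conjugated_derivative (x x' : C -> C) :
  derivative_on_disk x x' ->
  derivative_on_disk (fun z => z * (E z * x z))%C
    (fun z => E z * ((z * x' z + b * x z) + g z / lam * x z))%C.
Proof.
  intros Hx z Hz. eapply is_cderive_eq. apply derivative_of_id_mult; auto.
  apply derivative_on_disk_mult; eauto. cbn beta.
  destruct (Eb z Hz) as (_ & _ & EE).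
  replace (E z * x z + z * (E' z * x z + E z * x' z))%C with
    (E z * x z + z * E z * x' z + / lam * (lam * (z * E' z)) * x z)%C by (field; auto).
  rewrite EE. unfold b. field. auto.
Qed.

(** As [f / z = E x], the derivative of [C_g f] is [E x g], which cancels the term
    [lam E (g / lam) x] of [lam f']. *)
Lemma conjugated_op_shift (f x x' : C -> C) :
  derivative_on_disk x x' -> (forall z, in_disk z -> f z = (z * (E z * x z))%C) ->
  derivative_on_disk (op_shift (alexander_op g) lam f)
    (fun z => - lam * E z * (z * x' z + b * x z))%C.
Proof.
  intros Hx Ef z Hz. eapply is_cderive_eq.
  apply (op_shift_derivative lam g g' f (fun z => E z * ((z * x' z + b * x z) + g z / lam * x z))%C
    (fun z => E z * x z)%C (fun z => E' z * x z + E z * x' z)%C); auto.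
  - intros w Hw. apply (is_cderive_ext_on_disk (fun z => z * (E z * x z))%C); auto.
    intros v Hv. symmetry. auto. now apply conjugated_derivative.
  - apply derivative_on_disk_mult; auto.
  - cbn beta. field. auto.
Qed.

Lemma conjugated_in_bloch0 (x x' : C -> C) (K L : R) :
  derivative_on_disk x x' -> weighted_bound alpha x K ->
  weighted_bound alpha (fun z => z * x' z + b * x z)%C L ->
  in_bloch0 alpha (fun z => z * (E z * x z))%C /\
  bloch_norm alpha (fun z => z * (E z * x z))%C <= (L + K * (M / Cmod lam)) * B.
Proof.
  intros Hx HK HL.
  destruct (bloch_of_weighted_bound alpha (fun z => z * (E z * x z))%C _ ((L + K * (M / Cmod lam)) * B)
    (conjugated_derivative x x' Hx)) as [H1 H2].
  - intros z Hz. rewrite (Cmult_comm (E z)).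
    apply (weighted_bound_mult alpha _ B (fun z => (z * x' z + b * x z) + g z / lam * x z)%C E); auto.
    2: intros; now apply Eb. clear z Hz.
    apply (weighted_bound_plus alpha L _ (fun z => z * x' z + b * x z)%C (fun z => g z / lam * x z)%C HL).
    intros z Hz. rewrite (Cmult_comm _ (x z)).
    apply (weighted_bound_mult alpha K _ x (fun z => g z / lam)%C); auto.
    intros w Hw. rewrite Cmod_div by auto. apply Rmult_le_compat_r; auto.
    apply Rlt_le, Rinv_0_lt_compat. now apply Cmod_gt_0.
  - split; auto. split; auto. apply Cmult_0_l.
Qed.

Lemma inv_factor_analytic : derivative_on_disk (fun z => / E z)%C (fun z => E' z * - / (E z * E z))%C.
Proof. intros z Hz. apply (is_cderive_comp Cinv). now apply is_cderive_inv. now apply HE. Qed.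

Lemma bloch0_factorization (f : C -> C) :
  in_bloch0 alpha f -> exists x x' : C -> C, derivative_on_disk x x' /\
    (forall z, in_disk z -> f z = (z * (E z * x z))%C).
Proof.
  intros [Hf H0]. destruct (derivative_on_disk_exists f (proj1 Hf)) as [f' Hf'].
  destruct (analytic_division_at_0 f f' Hf' H0) as (q & q' & Hq & Ef & _).
  eexists. eexists. split.
  - apply (derivative_on_disk_mult q q' _ _ Hq inv_factor_analytic).
  - intros z Hz. rewrite Ef by auto. field. auto.
Qed.

(** Equal images have equal derivatives; after division by [- lam E], [x - y] solves the homogeneous
    Euler equation. *)
Lemma op_shift_injective (f1 f2 : C -> C) :
  (forall n : nat, b <> RtoC (- INR n)) -> in_bloch0 alpha f1 -> in_bloch0 alpha f2 ->
  eq_on_disk (op_shift (alexander_op g) lam f1) (op_shift (alexander_op g) lam f2) ->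
  eq_on_disk f1 f2.
Proof.
  intros Hb H1 H2 H.
  destruct (bloch0_factorization f1 H1) as (x & x' & Hx & Ef1).
  destruct (bloch0_factorization f2 H2) as (y & y' & Hy & Ef2).
  assert (D : forall z, in_disk z -> (x z - y z)%C = RtoC 0).
  { apply (euler_unique b (fun z => x z - y z)%C (fun z => x' z - y' z)%C Hb).
    - intros z Hz. apply is_cderive_minus; auto.
    - intros z Hz.
      assert (D : (- lam * E z * (z * x' z + b * x z))%C = (- lam * E z * (z * y' z + b * y z))%C).
      { apply (is_cderive_unique (op_shift (alexander_op g) lam f2) z).
        - apply (is_cderive_ext_on_disk (op_shift (alexander_op g) lam f1)); auto.
          now apply (conjugated_op_shift f1 x x').
        - now apply (conjugated_op_shift f2 y y'). }
      transitivity ((- / (lam * E z)) * (- lam * E z * (z * x' z + b * x z) - - lam * E z * (z * y' z + b * y z)))%C.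
      field. auto. rewrite D. ring. }
  intros z Hz. rewrite Ef1, Ef2 by auto. specialize (D z Hz). apply Ceq_minus in D. now rewrite D.
Qed.

(** To reach [u], the Euler datum is [- u' / (lam E)]: the image then has derivative [u'], and both
    functions vanish at 0. *)
Lemma op_shift_surjective :
  (forall n : nat, b <> RtoC (- INR n)) ->
  exists K, forall u, in_bloch0 alpha u -> exists f, in_bloch0 alpha f /\
    eq_on_disk (op_shift (alexander_op g) lam f) u /\ bloch_norm alpha f <= K * bloch_norm alpha u.
Proof.
  intros Hb. destruct (euler_solvable_all alpha b Ha Hb) as (K & HK & Hsol).
  set (c := Cmod (- / lam)%C).
  (* [c * B] bounds [- 1 / (lam E)], [K] comes from the Euler equation, [M / Cmod lam] from the term
     [(g / lam) x], and the outer [B] from [E]. *)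
  exists ((c * B + K * (c * B) * (M / Cmod lam)) * B).
  intros u [Hu U0]. destruct (derivative_on_disk_exists u (proj1 Hu)) as [u' Hu'].
  destruct (derivative_on_disk_exists u') as [u'' Hu'']. { eapply derivative_is_analytic, Hu'. }
  pose proof (weighted_bound_of_bloch alpha u u' Hu Hu') as Bu.
  set (F := fun z => (- / lam * (u' z * / E z))%C).
  assert (BF : weighted_bound alpha F (c * (bloch_norm alpha u * B))).
  { apply weighted_bound_scal. apply weighted_bound_mult; auto. intros; now apply Eb. }
  assert (HF : derivative_on_disk F (fun z => - / lam * (u'' z * / E z + u' z * (E' z * - / (E z * E z))))%C).
  { intros z Hz. apply is_cderive_scal. apply (derivative_on_disk_mult _ _ _ _ Hu'' inv_factor_analytic z Hz). }
  destruct (Hsol F _ _ HF BF) as (x & x' & Hx & Ex & Bx).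
  destruct (conjugated_in_bloch0 x x' _ (c * (bloch_norm alpha u * B)) Hx Bx) as [Xf Nf].
  { intros z Hz. rewrite Ex by auto. now apply BF. }
  exists (fun z => z * (E z * x z))%C. split; [ | split]; auto.
  - apply (eq_on_disk_of_derivative _ _ u'); auto.
    + intros z Hz. eapply is_cderive_eq. apply (conjugated_op_shift _ x x'); auto.
      cbn beta. rewrite Ex by auto. unfold F. field. auto.
    + rewrite U0. apply op_shift_0. apply Cmult_0_l.
  - eapply Rle_trans. exact Nf. right. ring.
Qed.

End Conjugation.

(** * Regular values, eigenvalues and the point 0 *)

Lemma derivative_pow (n : nat) :
  derivative_on_disk (fun z => z ^ n)%C (fun z => RtoC (INR n) * z ^ (pred n))%C.
Proof.
  intros z _. induction n as [|n IH].
  - eapply is_cderive_eq. exact (is_cderive_const 1 z). simpl. ring.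
  - eapply is_cderive_eq. exact (is_cderive_mult _ _ z _ _ (is_cderive_id z) IH).
    rewrite S_INR, RtoC_plus. destruct n as [|n]; simpl pred.
    + simpl. ring.
    + rewrite Cpow_S. ring.
Qed.

(** Both kinds of spectral points are detected through this lower bound: a nonzero kernel element
    contradicts it, and so do approximate eigenvectors at 0. *)
Lemma invertible_bounded_below (alpha : R) (A : (C -> C) -> (C -> C)) :
  invertible_on (in_bloch0 alpha) (bloch_norm alpha) A ->
  exists K, forall f, in_bloch0 alpha f -> bloch_norm alpha f <= K * bloch_norm alpha (A f).
Proof.
  intros (HA & S & HS & SA & _ & K & HK). exists K. intros f Hf.
  eapply Rle_trans. 2: apply HK, HA, Hf.
  apply bloch_norm_le_of_eq_on_disk. apply HS, HA, Hf. now apply SA.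
Qed.

Lemma alexander_regular_value (alpha M : R) (lam : C) (g g' : C -> C) :
  0 <= alpha -> derivative_on_disk g g' -> (forall z, in_disk z -> Cmod (g z) <= M) ->
  lam <> RtoC 0 -> (forall n, (1 <= n)%nat -> lam <> (g 0 / RtoC (INR n))%C) ->
  invertible_on (in_bloch0 alpha) (bloch_norm alpha) (op_shift (alexander_op g) lam).
Proof.
  intros Ha Hg HM Hl Hn.
  destruct (integrating_factor M lam g g' Hl Hg HM) as (E & E' & B & HE & E0 & Eb).
  (* [b = - n] would mean [g 0 / lam = n + 1], hence the index [S n]. *)
  assert (Hb : forall n : nat, (1 - g 0 / lam)%C <> RtoC (- INR n)).
  { intros n N. apply (Hn (S n)). lia.
    assert (X : (g 0 / lam)%C = RtoC (INR (S n))).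
    { rewrite S_INR, RtoC_plus. replace (g 0 / lam)%C with (1 - (1 - g 0 / lam))%C by ring.
      rewrite N, RtoC_opp. ring. }
    assert (Y : RtoC (INR (S n)) <> RtoC 0).
    { intros Y. apply RtoC_inj in Y. pose proof (lt_0_INR (S n) ltac:(lia)). lra. }
    rewrite <- X in *. assert (g 0 <> RtoC 0).
    { intros Z. apply Y. rewrite Z. field. auto. }
    field. split; auto. }
  split. { intros f Hf. eapply op_shift_in_bloch0; eauto. }
  destruct (op_shift_surjective alpha M B lam g g' E E' Ha Hl Hg HM HE E0 Eb Hb) as [K HK].
  (* The inverse must be a total map on [C -> C]; outside the space its value is arbitrary. *)
  assert (Ch : forall u, exists f, in_bloch0 alpha u -> in_bloch0 alpha f /\
    eq_on_disk (op_shift (alexander_op g) lam f) u /\ bloch_norm alpha f <= K * bloch_norm alpha u).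
  { intros u. destruct (classic (in_bloch0 alpha u)) as [Hu|Hu].
    - destruct (HK u Hu) as [f Hf]. now exists f.
    - exists u. intros. contradiction. }
  destruct (functional_choice _ _ _ Ch) as [S HS]. exists S. split; [ | split; [ | split]].
  - intros f Hf. now apply HS.
  (* The left inverse property follows from the right one: [S (T f)] and [f] have the same image
     under the injective operator [T]. *)
  - intros f Hf. assert (X : in_bloch0 alpha (op_shift (alexander_op g) lam f)) by (eapply op_shift_in_bloch0; eauto).
    apply (op_shift_injective alpha B lam g g' E E' Hl Hg HE E0 Eb); auto; now apply HS.
  - intros f Hf. now apply HS.
  - exists K. intros f Hf. now apply HS.
Qed.

Lemma alexander_eigenvalue (alpha M : R) (lam : C) (n : nat) (g g' : C -> C) :
  0 <= alpha -> derivative_on_disk g g' -> (forall z, in_disk z -> Cmod (g z) <= M) ->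
  lam <> RtoC 0 -> (1 <= n)%nat -> lam = (g 0 / RtoC (INR n))%C ->
  ~ invertible_on (in_bloch0 alpha) (bloch_norm alpha) (op_shift (alexander_op g) lam).
Proof.
  intros Ha Hg HM Hl Hn Elam Inv. destruct n as [|m]. lia.
  destruct (integrating_factor M lam g g' Hl Hg HM) as (E & E' & B & HE & E0 & Eb).
  assert (Y : RtoC (INR (S m)) <> RtoC 0).
  { intros Y. apply RtoC_inj in Y. pose proof (lt_0_INR (S m) ltac:(lia)). lra. }
  assert (Eg : g 0 = (lam * RtoC (INR (S m)))%C) by (rewrite Elam; field; auto).
  (* Here [n = m + 1], so [b = - m]. For [m = 0] the truncated exponent [pred m] is multiplied by
     0. *)
  assert (Z : forall z, (z * (RtoC (INR m) * z ^ pred m) + (1 - g 0 / lam) * z ^ m)%C = RtoC 0).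
  { intros z. rewrite Eg. replace (lam * RtoC (INR (S m)) / lam)%C with (RtoC (INR (S m))) by (field; auto).
    rewrite S_INR, RtoC_plus. destruct m as [|m]. simpl. ring. simpl pred. rewrite Cpow_S. ring. }
  assert (P1 : forall z, in_disk z -> Cmod (z ^ m)%C <= 1).
  { intros z Hz. rewrite Cmod_pow. rewrite <- (pow1 m). apply pow_incr.
    pose proof (Cmod_ge_0 z). unfold in_disk in Hz. lra. }
  set (f := fun z => (z * (E z * z ^ m))%C).
  assert (Xf : in_bloch0 alpha f).
  { apply (conjugated_in_bloch0 alpha M B lam g E E' Hl HM HE Eb (fun z => z ^ m)%C _ 1 0 (derivative_pow m)).
    - intros z Hz. pose proof (weight_pos alpha z). pose proof (weight_le_1 alpha z Ha Hz).
      specialize (P1 z Hz). pose proof (Cmod_ge_0 (z ^ m)%C). nra.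
    - intros z Hz. rewrite Z, Cmod_0, Rmult_0_r. lra. }
  destruct (invertible_bounded_below alpha _ Inv) as [K HK]. specialize (HK f Xf).
  assert (N0 : bloch_norm alpha (op_shift (alexander_op g) lam f) = 0).
  { assert (Xo : in_bloch0 alpha (op_shift (alexander_op g) lam f)) by (eapply op_shift_in_bloch0; eauto).
    apply Rle_antisym. 2: apply bloch_norm_nonneg, Xo.
    eapply (bloch_of_weighted_bound alpha _ _ 0).
    - apply (conjugated_op_shift B lam g g' E E' Hl Hg HE Eb f _ _ (derivative_pow m)). reflexivity.
    - intros z Hz. cbn beta. rewrite Z, Cmult_0_r, Cmod_0. lra. }
  rewrite N0, Rmult_0_r in HK.
  (* The kernel function is nonzero because [z], [E z] and [z ^ m] are all nonzero at [1/2]. *)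
  assert (Hh : in_disk (RtoC (/ 2))) by (unfold in_disk; rewrite Cmod_RtoC_nonneg; lra).
  pose proof (bloch0_eq_0_of_norm_le_0 alpha f Xf HK _ Hh) as F0.
  assert (Hh0 : RtoC (/ 2) <> RtoC 0) by (intros N; apply RtoC_inj in N; lra).
  revert F0. unfold f. repeat apply Cmult_neq_0; auto. now apply Cpow_nz.
Qed.

(** For [u = c z^(n + 1)], [(C_g u)' = c z^n g = u' g / (n + 1)]. Pointwise comparison with [u']
    gives [M / (n + 1)]; the norm of the monomial only normalises and is never computed. *)
Lemma alexander_approx_eigenvalue_0 (alpha M : R) (g g' : C -> C) :
  0 <= alpha -> derivative_on_disk g g' -> (forall z, in_disk z -> Cmod (g z) <= M) ->
  approx_eigenvalue (in_bloch0 alpha) (bloch_norm alpha) (alexander_op g) 0.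
Proof.
  intros Ha Hg HM.
  assert (M0 : 0 <= M) by (eapply Rle_trans; [apply Cmod_ge_0 | apply (HM _ in_disk_0)]).
  set (N := fun n => bloch_norm alpha (fun z => z ^ S n)%C).
  assert (Hp : forall n, weighted_bound alpha (fun z => RtoC (INR (S n)) * z ^ n)%C (INR (S n))).
  { intros n z Hz. rewrite Cmod_mult, Cmod_pow, Cmod_RtoC_nonneg by apply pos_INR.
    pose proof (pos_INR (S n)). pose proof (weight_pos alpha z). pose proof (weight_le_1 alpha z Ha Hz).
    pose proof (Cmod_ge_0 z). unfold in_disk in Hz.
    assert (Cmod z ^ n <= 1) by (rewrite <- (pow1 n); apply pow_incr; lra).
    assert (0 <= Cmod z ^ n) by now apply pow_le.
    assert (INR (S n) * Cmod z ^ n <= INR (S n)) by nra.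
    assert (0 <= INR (S n) * Cmod z ^ n) by now apply Rmult_le_pos. nra. }
  assert (Xp : forall n, in_bloch0 alpha (fun z => z ^ S n)%C).
  { intros n. split. apply (bloch_of_weighted_bound alpha _ _ _ (derivative_pow (S n)) (Hp n)).
    simpl. apply Cmult_0_l. }
  assert (Bp : forall n, weighted_bound alpha (fun z => RtoC (INR (S n)) * z ^ n)%C (N n)).
  { intros n. exact (weighted_bound_of_bloch alpha _ _ (proj1 (Xp n)) (derivative_pow (S n))). }
  assert (N0 : forall n, 0 < N n).
  { intros n. apply Rnot_le_lt. intros L.
    assert (Hh : in_disk (RtoC (/ 2))) by (unfold in_disk; rewrite Cmod_RtoC_nonneg; lra).
    assert (Hh0 : RtoC (/ 2) <> RtoC 0) by (intros X; apply RtoC_inj in X; lra).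
    pose proof (bloch0_eq_0_of_norm_le_0 alpha _ (Xp n) L _ Hh) as F0.
    revert F0. now apply Cpow_nz. }
  set (c := fun n => RtoC (/ N n)).
  assert (Hc : forall n, Cmod (c n) = / N n).
  { intros n. apply Cmod_RtoC_nonneg. now apply Rlt_le, Rinv_0_lt_compat. }
  set (u := fun n z => (c n * z ^ S n)%C).
  assert (Du : forall n, derivative_on_disk (u n) (fun z => c n * (RtoC (INR (S n)) * z ^ n))%C).
  { intros n z Hz. apply is_cderive_scal. now apply (derivative_pow (S n)). }
  assert (Bu : forall n, weighted_bound alpha (fun z => c n * (RtoC (INR (S n)) * z ^ n))%C 1).
  { intros n. replace 1 with (Cmod (c n) * N n) by (rewrite Hc; field; apply Rgt_not_eq, N0).
    apply (weighted_bound_scal alpha (N n) (c n) (fun z => RtoC (INR (S n)) * z ^ n)%C). apply Bp. }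
  assert (Xu : forall n, in_bloch0 alpha (u n)).
  { intros n. split. apply (bloch_of_weighted_bound alpha _ _ _ (Du n) (Bu n)).
    unfold u. simpl. now rewrite Cmult_0_l, Cmult_0_r. }
  exists u. split; [exact Xu | split].
  - intros n. apply Rle_antisym. apply (bloch_of_weighted_bound alpha _ _ _ (Du n) (Bu n)).
    (* Lower bound by homogeneity: [N n] times the norm of [u n] bounds the norm [N n] of the
       monomial. *)
    apply (Rmult_le_reg_l (N n)). apply N0. rewrite Rmult_1_r.
    apply (bloch_of_weighted_bound alpha _ _ _ (derivative_pow (S n))).
    intros z Hz. pose proof (weighted_bound_of_bloch alpha _ _ (proj1 (Xu n)) (Du n) z Hz) as W.
    cbn beta in W. rewrite Cmod_mult, Hc in W. simpl pred.
    apply (Rmult_le_compat_l (N n)) in W. 2: apply Rlt_le, N0.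
    match type of W with _ * (?w * (_ * ?v)) <= _ =>
      replace (N n * (w * (/ N n * v))) with (w * v) in W by (field; apply Rgt_not_eq, N0) end.
    exact W.
  - apply (is_lim_seq_le_le (fun _ => 0) _ (fun n => M * / INR (S n))).
    + intros n.
      assert (Xo : in_bloch0 alpha (op_shift (alexander_op g) 0 (u n))) by (eapply op_shift_in_bloch0; eauto).
      split. apply bloch_norm_nonneg, Xo.
      apply (bloch_of_weighted_bound alpha _ (fun z => (c n * z ^ n) * g z
         - 0 * (c n * (RtoC (INR (S n)) * z ^ n)))%C).
      * eapply op_shift_derivative; eauto.
        intros z Hz. apply is_cderive_scal. apply (derivative_pow n); auto.
        intros z Hz. unfold u. rewrite Cpow_S. ring.
      * intros z Hz. specialize (Bu n z Hz). specialize (HM z Hz). cbn beta in Bu.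
        pose proof (lt_0_INR (S n) ltac:(lia)) as P. pose proof (weight_pos alpha z).
        replace (c n * z ^ n * g z - 0 * (c n * (RtoC (INR (S n)) * z ^ n)))%C with (c n * z ^ n * g z)%C by ring.
        replace (c n * (RtoC (INR (S n)) * z ^ n))%C with (RtoC (INR (S n)) * (c n * z ^ n))%C in Bu by ring.
        rewrite Cmod_mult, Cmod_RtoC_nonneg in Bu by lra. rewrite Cmod_mult.
        pose proof (Cmod_ge_0 (c n * z ^ n)%C). pose proof (Cmod_ge_0 (g z)).
        apply (Rmult_le_reg_l (INR (S n))). exact P.
        replace (INR (S n) * (M * / INR (S n))) with (1 * M) by (field; lra).
        match goal with |- _ * (?w * (?v * _)) <= _ =>
          replace (INR (S n) * (w * (v * Cmod (g z)))) with (w * (INR (S n) * v) * Cmod (g z)) by ring end.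
        apply Rmult_le_compat; auto. apply Rmult_le_pos. lra. apply Rmult_le_pos; lra.
    + apply is_lim_seq_const.
    + replace (Finite 0) with (Rbar_mult M 0) by (simpl; f_equal; ring).
      apply is_lim_seq_scal_l. apply (is_lim_seq_incr_1 (fun n => / INR n)).
      replace (Finite 0) with (Rbar_inv p_infty) by reflexivity.
      apply is_lim_seq_inv. apply is_lim_seq_INR. discriminate.
Qed.

Theorem theorem5p3 (alpha : R) (k : nat) (a : nat -> C) (h : C -> C) :
  0 < alpha ->
  (1 <= k)%nat ->
  (forall j, (1 <= j <= k)%nat -> 0 < Cmod (a j)) ->
  analytic_on_disk h ->
  bounded_on_disk h ->
  let g0 : C -> C := fun w => Cplus (sum_n_m a 1 k) (h w) in
  (forall lam : C,
     in_spectrum (in_bloch0 alpha) (bloch_norm alpha) (alexander_op g0) lam <->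
     (lam = RtoC 0 \/
      exists n : nat, (1 <= n)%nat /\ lam = Cdiv (g0 (RtoC 0)) (RtoC (INR n)))) /\
  approx_eigenvalue (in_bloch0 alpha) (bloch_norm alpha) (alexander_op g0) (RtoC 0).
Proof.
  intros Halpha _ _ Hh [M HM] g0.
  assert (Ha : 0 <= alpha) by lra.
  destruct (derivative_on_disk_exists h Hh) as [h' Hh'].
  assert (Hg : derivative_on_disk g0 h').
  { intros z Hz. eapply is_cderive_eq. apply is_cderive_plus. apply is_cderive_const. now apply Hh'. ring. }
  assert (Mg : forall z, in_disk z -> Cmod (g0 z) <= Cmod (sum_n_m a 1 k) + M).
  { intros z Hz. eapply Rle_trans. apply Cmod_triangle. apply Rplus_le_compat_l. now apply HM. }
  pose proof (alexander_approx_eigenvalue_0 alpha _ g0 h' Ha Hg Mg) as Approx.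
  split; [ | exact Approx].
  intros lam. unfold in_spectrum. split.
  - intros Sp. apply NNPP. intros N. apply not_or_and in N as [N1 N2]. apply Sp.
    apply (alexander_regular_value alpha _ lam g0 h' Ha Hg Mg N1).
    intros n Hn E. apply N2. now exists n.
  (* The split is on [lam = 0] and not on the alternatives, since for [g0 0 = 0] the second one also
     gives [lam = 0]. At 0, invertibility would force [1 <= K * bloch_norm] of the images of [u n],
     which tends to 0. *)
  - intros D Inv. destruct (Ceq_dec lam 0) as [->|L].
    + destruct (invertible_bounded_below alpha _ Inv) as [K HK]. destruct Approx as (u & Xu & Nu & Lu).
      apply (is_lim_seq_scal_l _ K) in Lu. simpl in Lu. rewrite Rmult_0_r in Lu.
      assert (X : Rbar_le 1 0).
      { apply (is_lim_seq_le (fun _ => 1) (fun n => K * bloch_norm alpha (op_shift (alexander_op g0) 0 (u n)))).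
        - intros n. rewrite <- (Nu n). now apply HK.
        - apply is_lim_seq_const.
        - exact Lu. }
      simpl in X. lra.
    + destruct D as [->|(n & Hn & E)]. now apply L.
      now apply (alexander_eigenvalue alpha _ lam n g0 h' Ha Hg Mg L Hn E).
Qed.
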